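(* Suppose that $G$ is a finite group acting transitively, faithfully and with fixity $4$ on a set $\Omega$. Let $P$ be a Sylow $3$-subgroup of $G$, let $\Delta$ be the union of the $P$-orbits of length at most $3$ on $\Omega$ and let $K$ denote the set-wise stabilizer of $\Delta$ in $G$. Moreover let $\alpha \in \Omega$. Then one of the following holds: (a) $G_\alpha$ has even order. (b) There is a subnormal subgroup $N$ of $G$ such that one of the following holds: (i) $N \unlhd G$, $|G:N|$ divides $3$ and $\gcd(|N_\alpha|, 6) = 1$, or (ii) $|G:N|$ divides $9$, $K \cap N$ is strongly $3$-embedded in $N$ and $1 \leq |\Delta| \leq 4$. (c) One of the following four exceptional possibilities occurs: (i) $|P| = 3$ and $|N_G(P)|_2 \le 4$, (ii) $P$ is elementary abelian of order $9$, (iii) $P$ is extra-special of exponent $3$ and order $27$, or (iv) $P \cong C_3 \wr C_3$.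
   Context: All groups and sets are finite. A group $G$ acting transitively and faithfully on $\Omega$ has fixity $4$ if some nontrivial element of $G$ fixes exactly $4$ points of $\Omega$ and no nontrivial element fixes more than $4$ points. $G_\alpha$ denotes the stabilizer of $\alpha$ in $G$ and $N_\alpha = N\cap G_\alpha$. For a natural number $m$ and a prime $p$, $m_p$ is the largest power of $p$ dividing $m$. $C_n$ is the cyclic group of order $n$. For a prime $p$, a proper subgroup $M$ of a group $X$ is strongly $p$-embedded in $X$ if $p$ divides $|M|$ and $p$ does not divide $|M\cap M^g|$ for every $g\in X\setminus M$. *)

(* Defs.v *)
From HB Require Import structures.
From mathcomp Require Import all_boot all_order all_algebra.
From mathcomp Require Import all_fingroup all_solvable.

Set Implicit Arguments.
Unset Strict Implicit.
Unset Printing Implicit Defensive.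

Local Open Scope group_scope.

Definition has_fixity (gT : finGroupType) (rT : finType)
    (to : {action gT &-> rT}) (G : {group gT}) (Omega : {set rT})
    (k : nat) : Prop :=
  (exists2 g, g \in G^# & #|'Fix_(Omega | to)[g]| = k) /\
  (forall g, g \in G^# -> #|'Fix_(Omega | to)[g]| <= k).

Definition strongly_embedded (p : nat) (gT : finGroupType)
    (M X : {group gT}) : Prop :=
  [/\ M \proper X, p %| #|M|
    & forall g, g \in X :\: M -> ~~ (p %| #|M :&: M :^ g|)].

(* The regular wreath product of A by H: the semidirect product of the group  *)
(* of functions H -> A, with pointwise multiplication, by H acting on         *)
(* arguments by translation. Left translation turns into a right action,      *)
(* as mathcomp requires.                                                      *)
Section Wreath.

Variables A H : finGroupType.

Definition wreath_base : finGroupType := {dffun forall _ : H, A}.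

Definition wreath_shift (f : wreath_base) (h : H) : wreath_base :=
  [ffun x => f (h * x)].

Fact wreath_shift_is_action : is_action [set: H] wreath_shift.
Proof.
split=> [h f1 f2 /ffunP eq_f | f h k _ _]; apply/ffunP=> x.
  by have:= eq_f (h^-1 * x); rewrite !ffunE mulKVg.
by rewrite !ffunE mulgA.
Qed.

Definition wreath_action := Action wreath_shift_is_action.

Fact wreath_action_is_groupAction :
  is_groupAction [set: wreath_base] wreath_action.
Proof.
move=> h _; rewrite inE; apply/andP; split.
  by apply/subsetP=> f _; rewrite inE.
apply/morphicP=> f1 f2 _ _; rewrite !actpermE /=.
by apply/ffunP=> x; rewrite !ffunE.
Qed.

Definition wreath_groupAction := GroupAction wreath_action_is_groupAction.

Definition wreath : finGroupType := sdprod_by wreath_groupAction.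

End Wreath.

(* Main.v *)
Require Import Defs.
From mathcomp Require Import all_boot all_order all_algebra.
From mathcomp Require Import all_fingroup all_solvable.

Local Open Scope group_scope.

(* Suppose that point stabilisers have odd order and that 3 divides them. A   *)
(* nontrivial element of P fixes either exactly the set F0 of fixed points of *)
(* P, or three further points; in the second case it is called big here, and  *)
(* |F0| <= 1. If |P| >= 9 and no element is big then K is strongly embedded   *)
(* in G. Otherwise a normal subgroup N of 3-power index is obtained as the    *)
(* kernel of a transfer G -> P / Q, and the point is to control the fusion of *)
(* the relevant elements of P modulo Q. By a version of Alperin's theorem     *)
(* this reduces to the action of N_G(R) on R for R <= P with C_P(R) <= R.     *)
(* Involutions fix no point, so they stabilise no set of odd size; this makes *)
(* almost all these N_G(R) of odd order. Then N_G(R) acts trivially on        *)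
(* sections of order 3, and as a 3-group on R if |R : R'| <= 9.               *)
(* If some central element z is big, Q is the stabiliser in P of a point of   *)
(* Fix z outside F0; it has index 3 in P. If a big element x exists but no    *)
(* central one, then C_P(x) has order 9, whence |P : P'| = 9, and Q is P' if  *)
(* |F0| = 1, and a suitable maximal subgroup without big elements if F0 is    *)
(* empty. Such a maximal subgroup is missing only if P is extraspecial of     *)
(* order 27 and exponent 3. In particular (c)(iv) is never needed.            *)

(** * Fusion and transfer *)

(** Counting fixed points modulo 3, with at most 4 available, gives the dichotomy of [small_or_big];
    by [big_TI], two elements of [P^#] whose fixed sets share a point outside [F0] have equal fixed
    sets. Strong embedding comes from rigidity of fixed sets ([strongly_embedded_fix]): if all
    nontrivial elements of [P :&: N] have fixed set [Delta], then an element of order 3 common to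
    [K :&: N] and a conjugate of it pins [Delta] down. So a normal subgroup [N] of small index must
    be found that excludes the elements of [P] with the wrong fixed set. [local_fusion] and
    [transfer_kernel] reduce this to the local groups ['N_G(R)], whose order is shown to be odd by
    [no_involution_odd]; [odd_norm_index3] and [norm_odd_sylow_cent] then control their action.
    [fixity4_cases] collects the outcomes: [card3_normaliser2] for order 3,
    [strongly_embedded_small] without big elements, [central_big_strongly_embedded] with a central
    one, and otherwise [noncentral_big_strongly_embedded] if [F0] is a point, or
    [index3_normal_or_extraspecial] followed by [fusion_index3_normal] if [F0] is empty. *)

Section Fusion.

Variables (gT : finGroupType) (p : nat) (G P : {group gT}).
Hypothesis sylP : p.-Sylow(G) P.

(** A Sylow subgroup of ['N_G(R)] containing [R] is conjugated into [P], rather than [R] alone. *)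
Lemma fully_normalized_conj (R : {group gT}) : R \subset P ->
  exists2 h, h \in G
    & R :^ h \subset P /\ p.-Sylow('N_G(R :^ h)) 'N_P(R :^ h).
Proof.
move=> sRP; have pP := pHall_pgroup sylP; have sPG := pHall_sub sylP.
have [S sylS sRS] : {S : {group gT} | p.-Sylow('N_G(R)) S & R \subset S}.
  apply: Sylow_superset (pgroupS sRP pP).
  by rewrite subsetI normG (subset_trans sRP sPG).
have [sSN pS _] := and3P sylS; have [sSG nRS] := subsetIP sSN.
have [h Gh sShP] := Sylow_Jsub sylP sSG pS.
exists h => //; have sRhP : R :^ h \subset P.
  by apply: subset_trans sShP; rewrite conjSg.
split=> //; have sylSh : p.-Sylow('N_G(R :^ h)) (S :^ h).
  by have:= sylS; rewrite -(pHallJ2 _ _ _ h) conjIg -normJ (conjGid Gh).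
have pNP : p.-group 'N_P(R :^ h) by apply: pgroupS pP; apply: subsetIl.
have sNN : 'N_P(R :^ h) \subset 'N_G(R :^ h) by rewrite setSI.
have sShN : S :^ h \subset 'N_P(R :^ h) by rewrite subsetI sShP normJ conjSg.
by rewrite (sub_pHall sylSh pNP sShN sNN).
Qed.

(* Downward induction on R as in Alperin's theorem: a conjugation between     *)
(* subgroups of P extends from R to N_P(R) > R, up to an element normalising  *)
(* a fully normalised conjugate S of R; and by the Frattini argument for      *)
(* C_P(S) in C_G(S), that element may be taken to normalise S C_P(S).         *)
Lemma local_fusion (X : {set gT}) (Q : {group gT}) :
    G \subset 'N(X) ->
    (forall R : {group gT}, R \subset P -> 'C_P(R) \subset R ->
       p.-Sylow('N_G(R)) 'N_P(R) ->
       {in 'N_G(R) & R :&: X, forall n r, r^-1 * r ^ n \in Q}) ->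
  {in P :&: X & G, forall w g, w ^ g \in P -> w^-1 * w ^ g \in Q}.
Proof.
move=> nXG locQ; have pP := pHall_pgroup sylP; have sPG := pHall_sub sylP.
have XJ x g : x \in X -> g \in G -> x ^ g \in X.
  by move=> Xx /(subsetP nXG) nXg; rewrite memJ_norm.
suffices main m (R : {group gT}) g : #|P| - #|R| < m -> R \subset P -> g \in G ->
    R :^ g \subset P -> {in R :&: X, forall r, r^-1 * r ^ g \in Q}.
  move=> w g /setIP[Pw Xw] Gg Pwg.
  apply: (main _ <[w]>%G g (ltnSn _)); rewrite ?cycle_subG ?inE ?cycle_id //.
  by rewrite -cycleJ cycle_subG.
elim: m => // m IHm in R g *.
rewrite ltnS => leRm sRP Gg sRgP.
have [h Gh [sRhP sylN]] := fully_normalized_conj R sRP.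
have IH (T : {group gT}) k : #|R| < #|T| -> T \subset P -> k \in G ->
    T :^ k \subset P -> {in T :&: X, forall r, r^-1 * r ^ k \in Q}.
  move=> ltRT sTP; apply: IHm => //; apply: leq_trans leRm.
  by rewrite ltn_sub2l // (leq_trans ltRT) // subset_leq_card.
set S := (R :^ h)%G in sRhP sylN.
have nS n : n \in 'N_G(S) -> {in S :&: X, forall r, r^-1 * r ^ n \in Q}.
  move=> Nn; have [sCS | nsCS] := boolP ('C_P(S) \subset S).
    by move=> r Sr; apply: locQ Sr.
  have nCN : 'C_G(S) <| 'N_G(S) := subcent_normal _ _.
  have sylC : p.-Sylow('C_G(S)) 'C_P(S).
    have := Sylow_setI_normal nCN sylN; congr (pHall _ _ _).
    by rewrite setIACA [G :&: P](setIidPr sPG) (setIidPl (cent_sub S)).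
  have [c Cc [m' Nm ->]] : exists2 c, c \in 'C_G(S)
      & exists2 m', m' \in 'N_('N_G(S))('C_P(S)) & n = c * m'.
    move: Nn; rewrite -{1}(Frattini_arg nCN sylC) => /mulsgP[c d Cc Nd ->].
    by exists c => //; exists d.
  move=> r /setIP[Sr Xr]; have [[Gc cSc] [NGm nCm]] := (setIP Cc, setIP Nm).
  have [Gm nSm] := setIP NGm; rewrite conjgM [r ^ c]conjgE -(centP cSc r Sr) mulKg.
  have nSCm : m' \in 'N(S <*> 'C_P(S)) by rewrite -cycle_subG normsY ?cycle_subG.
  apply: (IH (S <*> 'C_P(S))%G m').
  - rewrite -(cardJg R h) proper_card // properE joing_subl join_subG subxx.
    exact: nsCS.
  - by rewrite join_subG sRhP subsetIl.
  - exact: Gm.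
  - by rewrite (normP nSCm) join_subG sRhP subsetIl.
  by rewrite inE Xr (subsetP (joing_subl S _)).
(* If [R1] is proper in [P], Sylow's theorem in ['N_G(S)] corrects [k] by some [n] so that [k * n]
   carries the larger group ['N_P(R1)] into [P]; induction handles [k * n], and [nS] handles [n]. *)
have toS (R1 : {group gT}) k : R1 \subset P -> k \in G -> R1 :^ k = S ->
    {in R1 :&: X, forall r, r^-1 * r ^ k \in Q}.
  move=> sR1P Gk defS r /setIP[R1r Xr].
  have oR1 : #|R1| = #|R| by rewrite -(cardJg R1 k) defS cardJg.
  have [eqR1P | neqR1P] := eqVneq (R1 : {set gT}) P.
    have eqSP : S = R1.
      by apply/group_inj/eqP; rewrite eqEcard /= cardJg oR1 eqR1P sRhP leqnn.
    have nSk : S :^ k = S by rewrite [in LHS]eqSP.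
    by apply: nS; [rewrite inE Gk inE nSk /= | rewrite inE eqSP R1r].
  have ltRN : #|R| < #|'N_P(R1)|.
    rewrite -oR1 proper_card // nilpotent_proper_norm ?(pgroup_nil pP) //.
    by rewrite properEneq neqR1P.
  have pN : p.-group ('N_P(R1) :^ k) by rewrite pgroupJ (pgroupS _ pP) ?subsetIl.
  have sNN : 'N_P(R1) :^ k \subset 'N_G(S).
    rewrite conjIg -normJ /= defS; apply: setSI.
    by rewrite -(conjGid Gk) conjSg.
  have [n Nn sNkn] := Sylow_Jsub sylN sNN pN; have [Gn nSn] := setIP Nn.
  have Q1 : r^-1 * r ^ (k * n) \in Q.
    apply: (IH 'N_P(R1)%G) => //; rewrite ?subsetIl ?groupM //.
      by rewrite conjsgM (subset_trans sNkn) ?subsetIl.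
    by rewrite (in_setI r 'N_P(R1)) Xr inE (subsetP sR1P) ?(subsetP (normG R1)).
  have Q2 : (r ^ k)^-1 * (r ^ k) ^ n \in Q.
    by apply: nS; rewrite // inE XJ // andbT -defS memJ_conjg.
  move: (groupM Q1 (groupVr Q2)).
  by rewrite -conjgM invMg invgK mulgA mulgK.
(* Both [R] and [R :^ g] are carried onto [S], by [h] and by [g^-1 * h]; comparing the two gives the
   claim for [g]. *)
move=> r /setIP[Rr Xr].
have Q1 : r^-1 * r ^ h \in Q by apply: (toS R) => //; rewrite inE Rr.
have Q2 : (r ^ g)^-1 * (r ^ g) ^ (g^-1 * h) \in Q.
  apply: (toS (R :^ g)%G); rewrite ?groupM ?groupV //=.
    by rewrite -conjsgM mulKVg.
  by rewrite inE memJ_conjg Rr XJ.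
rewrite -conjgM mulKVg in Q2; have:= groupM Q1 (groupVr Q2).
by rewrite invMg invgK mulgA mulgK.
Qed.

End Fusion.

(** [N] is the kernel of the transfer to [P / Q]. For [w] in [P :&: X] each factor of the transfer
    is a conjugate of a power of [w], which by hypothesis agrees with that power modulo [Q]. So the
    transfer of [w] is the image of [w ^+ #|G : P|], and this exponent is prime to [p]. *)
Lemma transfer_kernel (gT : finGroupType) (p : nat) (G P Q : {group gT})
    (X : {set gT}) :
    p.-Sylow(G) P -> Q <| P -> abelian (P / Q) ->
    {in P :&: X, forall x k, x ^+ k \in X} ->
    {in P :&: X & G, forall w g, w ^ g \in P -> w^-1 * w ^ g \in Q} ->
  exists2 N : {group gT}, N <| G
    & #|G : N| %| #|P : Q| /\ P :&: N :&: X \subset Q.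
Proof.
move=> sylP nsQP abPQ powX fusX; have [sQP nQP] := andP nsQP.
have sPG := pHall_sub sylP; have pP := pHall_pgroup sylP.
pose al := restrm_morphism nQP (coset_morphism Q).
have imal : al @* P = P / Q by rewrite morphim_restrm setIid.
have abal : abelian (al @* P) by rewrite imal.
pose V : {morphism G >-> _} := transfer_morphism G abal.
exists ('ker V)%G; first exact: ker_normal.
split.
  have -> : #|G : 'ker V| = #|V @* G| by rewrite card_morphim setIid.
  have -> : #|P : Q| = #|[set: FiniteModule.fmod_of abal]|.
    rewrite cardsT card_sub -card_quotient // -imal.
    by apply: eq_card => x; rewrite inE.
  by apply: cardSg; apply: subsetT.
apply/subsetP=> w /setIP[/setIP[Pw kerw] Xw].
have Gw := subsetP sPG w Pw.
have trX := transversalP (rcosets_cycle_partition sPG Gw).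
move/mker: kerw; rewrite /= (transfer_cycle_expansion sPG abal Gw trX).
set Y := transversal _ _ in trX *.
rewrite (eq_bigr (fun x =>
  (FiniteModule.fmod abal (al w)) *+ #|<[w]> : P :* x|)%R); last first.
  move=> x Yx; set n := #|_ : _|.
  have Gx : x \in G by apply: subsetP Yx; apply: transversal_sub trX.
  have Pwx : (w ^+ n) ^ x^-1 \in P.
    by rewrite conjgE invgK mulgA -mem_rcoset mulg_exp_card_rcosets.
  have Pwn : w ^+ n \in P by rewrite groupX.
  have Qwx : (w ^+ n)^-1 * (w ^+ n) ^ x^-1 \in Q.
    by apply: fusX; rewrite ?groupV // inE Pwn powX ?inE ?Pw.
  have al_eq : al ((w ^+ n) ^ x^-1) = al (w ^+ n).
    by rewrite /= /restrm -{1}[_ ^ _](mulKVg (w ^+ n)) coset_kerr.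
  have alw : al w \in al @* P by rewrite mem_morphim.
  rewrite -(FiniteModule.fmodX _ n alw) -(morphX al) //.
  by congr (FiniteModule.fmod _ _).
rewrite GRing.sumrMnr (sum_index_rcosets_cycle sPG Gw trX).
have alw : al w \in al @* P by rewrite mem_morphim.
rewrite -(FiniteModule.fmodX _ _ alw) => /(congr1 val).
rewrite FiniteModule.fmodK ?groupX //.
rewrite FiniteModule.fmval0 => /eqP; rewrite -order_dvdn => dvdi.
have co : coprime #[al w] #|G : P|.
  apply: (pnat_coprime (pi := p)); last by case/and3P: sylP.
  exact: mem_p_elt (morphim_pgroup al pP) alw.
have : #[al w] == 1%N by rewrite -dvdn1 -(eqnP co) dvdn_gcd dvdnn.
by rewrite order_eq1 => /eqP; apply: coset_idr; apply: (subsetP nQP).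
Qed.

(** * Normalisers of odd order *)

Section Odd.

Variable gT : finGroupType.
Implicit Types (G P R S U W : {group gT}) (x g t w : gT).

(** Even powers of [g] centralise [x], and [g] equals its own even power with exponent [#[g] +
    1]. *)
Lemma conj_inv_odd (aT : finGroupType) (x g : aT) :
  x ^ g = x^-1 -> odd #[g] -> x ^+ 2 = 1.
Proof.
move=> xg odd_g; have inv2 k : x ^ (g ^+ k.*2) = x.
  elim: k => [|k IHk]; first by rewrite conjg1.
  by rewrite doubleS !expgSr !conjgM IHk xg conjVg xg invgK.
suffices eqx : x ^ g = x by rewrite expgS expg1 -{2}eqx xg mulgV.
have {2}<- := inv2 #[g]./2.+1; congr (_ ^ _).
by rewrite doubleS -[_.*2.+1]/(true + _) -odd_g odd_double_half expgS expg_order mulg1.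
Qed.

(** The two nontrivial elements of a group of order 3 are inverse to each other. *)
Lemma index3_coset U W x w : W <| U -> #|U : W| = 3 -> x \in U :\: W -> w \in U ->
  w \notin W -> (x^-1 * w \in W) || (x * w \in W).
Proof.
move=> nsWU oUW /setDP[Ux nWx] Uw nWw; have [sWU nWU] := andP nsWU.
have [nx nw] := (subsetP nWU x Ux, subsetP nWU w Uw).
have oQ : #|U / W| = 3 by rewrite card_quotient.
have ntx : coset W x != 1 by apply: contra nWx => /eqP/coset_idr->.
have ntw : coset W w != 1 by apply: contra nWw => /eqP/coset_idr->.
have oX : #[coset W x] = 3.
  have : #[coset W x] %| 3 by rewrite -oQ order_dvdG // mem_quotient.
  by rewrite dvdn_divisors // !inE order_eq1 (negPf ntx) => /eqP.
have : coset W w \in <[coset W x]>.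
  have -> : <[coset W x]> = U / W.
    by apply/eqP; rewrite eqEcard cycle_subG mem_quotient // oQ -orderE oX.
  exact: mem_quotient.
case/cyclePmin=> i; rewrite oX => lt_i3 def_w.
have [||] // : [\/ i = 0, i = 1 | i = 2]%N.
- by move: i lt_i3 {def_w} => [|[|[|]]] // _; constructor.
- by move=> i0; rewrite def_w i0 eqxx in ntw.
- move=> i1; apply/orP; left; apply: coset_idr; rewrite ?groupM ?groupV //.
  by rewrite morphM ?morphV ?groupV // [X in _ * X]def_w i1 mulVg.
move=> i2; apply/orP; right; apply: coset_idr; rewrite ?groupM //.
by rewrite morphM // [X in _ * X]def_w i2 -expgS -oX expg_order.
Qed.

(** The only nontrivial automorphism of [U / W] is inversion, which [conj_inv_odd] forbids for odd
    order. *)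
Lemma odd_norm_index3 U W g : W <| U -> #|U : W| = 3 ->
    g \in 'N(U) -> g \in 'N(W) -> odd #[g] ->
  {in U, forall r, r^-1 * r ^ g \in W}.
Proof.
move=> nsWU oUW nUg nWg odd_g r Ur; have [sWU nWU] := andP nsWU.
have [Wr | nWr] := boolP (r \in W); first by rewrite groupM ?groupV ?memJ_norm.
have /orP[//|] : (r^-1 * r ^ g \in W) || (r * r ^ g \in W).
  by apply: (index3_coset U); rewrite ?inE ?nWr ?memJ_norm.
have [nr ng] := (subsetP nWU r Ur, nWg).
move=> Wrr; have := @conj_inv_odd _ (coset W r) (coset W g).
have -> : coset W r ^ coset W g = (coset W r)^-1.
  apply/eqP; rewrite eq_sym eq_invg_mul -morphJ // -morphM ?groupJ //.
  by apply/eqP/coset_id.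
move/(_ erefl (dvdn_odd (morph_order (coset_morphism W) ng) odd_g)) => r2.
case/negP: nWr; apply: coset_idr => //; apply/eqP.
have := expg_cardG (mem_quotient W Ur).
by rewrite card_quotient // oUW expgS r2 mulg1 => ->.
Qed.

(* The pairs {w, w^-1} with w in U outside W are as many as the elements of W, *)
(* an odd number, so an involution must fix one of them.                       *)
Lemma involution_fix_pair U W t : W <| U -> #|U : W| = 3 -> odd #|W| ->
    #[t] = 2 -> (U :\: W) :^ t \subset U :\: W ->
  exists2 w, w \in U :\: W & w ^ t = w \/ w ^ t = w^-1.
Proof.
move=> nsWU oUW oddW ot nDt; have [sWU nWU] := andP nsWU.
have [x Ux nWx] : exists2 x, x \in U & x \notin W.
  by apply/subsetPn; rewrite -indexg_eq1 oUW.
have nWx2 : x ^+ 2 \notin W.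
  apply: contra nWx => Wx2; rewrite -(groupMr _ Wx2) -expgS -oUW -card_quotient //.
  have nx := subsetP nWU x Ux; apply: coset_idr; first by rewrite groupX.
  by rewrite morphX // expg_cardG ?mem_quotient.
pose pair (w : gT) := [set w; w^-1].
have pairV w : pair w^-1 = pair w by rewrite /pair invgK setUC.
have pairJ w : pair w :^ t = pair (w ^ t).
  by rewrite conjUg !conjg_set1 conjVg.
have sxWD : x *: W \subset U :\: W.
  apply/subsetP=> _ /lcosetP[w Ww ->].
  by rewrite inE groupMr // nWx groupM // (subsetP sWU).
have pairD w : w \in U :\: W -> exists2 v, v \in x *: W & pair w = pair v.
  case/setDP=> Uw nWw; have /orP[Wxw|Wxw] : (x^-1 * w \in W) || (x * w \in W).
    by apply: (index3_coset U); rewrite ?inE ?nWx.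
  - by exists w; rewrite // mem_lcoset.
  exists w^-1; rewrite // mem_lcoset -invMg groupV.
  have -> : w * x = (x * w) ^ x by rewrite conjgE !mulgA mulVg mul1g.
  by rewrite memJ_norm ?(subsetP nWU).
(* Every pair has exactly one member in the coset [x *: W], whence [#|S| = #|W|]. *)
pose S := pair @: (x *: W).
have cardS : #|S| = #|W|.
  rewrite card_in_imset ?card_lcoset // => u v xWu xWv eq_uv.
  have : u \in pair v by rewrite -eq_uv !inE eqxx.
  case/set2P=> // def_u.
  case/lcosetP: xWu xWv def_u => w1 Ww1 -> /lcosetP[w2 Ww2 ->] /eqP.
  rewrite eq_sym eq_invg_mul => /eqP eq1; case/negP: nWx2.
  have Ww : w2 ^ x * w1 \in W by rewrite groupM // memJ_norm ?(subsetP nWU).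
  by rewrite -(groupMr _ Ww) conjgE expgS expg1 !mulgA mulgK -mulgA eq1 group1.
have nSt : [acts <[t]>, on S | 'Js].
  rewrite cycle_subG !inE /=; apply/subsetP=> _ /imsetP[w xWw ->].
  have /pairD[v xWv eqv] : w ^ t \in U :\: W.
    by rewrite (subsetP nDt) // memJ_conjg (subsetP sxWD).
  by rewrite inE pairJ eqv imset_f.
have p2t : 2.-group <[t]> by rewrite /pgroup -orderE ot.
have := pgroup_fix_mod p2t nSt; rewrite cardS !modn2 oddW.
case: (set_0Vmem 'Fix_(S | 'Js)(<[t]>)) => [->|[A]]; first by rewrite cards0.
case/setIP=> /imsetP[w xWw ->] /afixP fixw _.
exists w; first exact: subsetP sxWD w xWw.
have : w ^ t \in pair w by rewrite -[pair w](fixw t (cycle_id t)) /= pairJ !inE eqxx.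
by case/set2P; [left | right].
Qed.

End Odd.

Lemma dvdn9P n : n %| 9 -> [\/ n = 1%N, n = 3 | n = 9].
Proof.
move=> dvn; have := dvdn_leq (isT : 0 < 9) dvn.
by move: n dvn; do 10?[case=> //]; constructor.
Qed.

Lemma der1_sub_Phi (gT : finGroupType) (p : nat) (R : {group gT}) :
  p.-group R -> R^`(1) \subset 'Phi(R).
Proof. by move=> pR; rewrite (Phi_joing pR) joing_subl. Qed.

(* A q-group with q > 3 acts trivially on a set R / R' of 1, 3 or 9 elements, *)
(* since its fixed points form a subgroup.                                    *)
Lemma cent_index9_der1 (gT : finGroupType) (q : nat) (R A : {group gT}) :
    3.-group R -> #|R : R^`(1)| %| 9 -> prime q -> 3 < q -> q.-group A ->
  A \subset 'N(R) -> A \subset 'C(R).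
Proof.
move=> pR oRR' q_pr q_gt3 qA nRA; have nsR'R := der_normal 1 R.
have nR'A : A \subset 'N(R^`(1)) by apply: char_norm_trans (der_char 1 R) nRA.
have coRA : coprime #|R| #|A|.
  apply: (pnat_coprime pR); apply: sub_in_pnat qA => r _ /eqnP->.
  by rewrite inE /=; apply: contraTneq q_gt3 => ->.
have acts_A : [acts A / R^`(1), on R / R^`(1) | 'J] by rewrite astabsJ quotient_norms.
have := pgroup_fix_mod (quotient_pgroup _ qA) acts_A; rewrite afixJ => fixV.
have cRA : 'C_(R / R^`(1))(A / R^`(1)) = R / R^`(1).
  apply/eqP; rewrite eqEcard subsetIl /=.
  have := cardSg (subsetIl (R / R^`(1)) 'C(A / R^`(1))).
  rewrite -(card_quotient (normal_norm nsR'R)) in oRR'; move: oRR' fixV.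
  have q2 : ~~ (q %| 2) by rewrite dvdn_prime2 // gtn_eqF // ltnW.
  have q3 : ~~ (q %| 3) by rewrite dvdn_prime2 // gtn_eqF.
  move: #|'C_(_)(_)| #|R / _| => n m dv9m eq_mn dv_nm; have := dvdn_trans dv_nm dv9m.
  move: dv_nm eq_mn => + /eqP + /dvdn9P[]def_n; move/dvdn9P: dv9m => [] ->;
    rewrite def_n // eqn_mod_dvd //= => _.
  - by rewrite (negPf q2).
  - by rewrite (@Euclid_dvdM 2 4 _ q_pr) (@Euclid_dvdM 2 2 _ q_pr) (negPf q2).
  by rewrite (@Euclid_dvdM 2 3 _ q_pr) (negPf q2) (negPf q3).
rewrite -coprime_quotient_cent ?der_sub ?(pgroup_sol pR) // in cRA.
have defR : 'Phi(R) <*> 'C_R(A) = R.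
  apply/eqP; rewrite eqEsubset join_subG Phi_sub subsetIl /=.
  apply: subset_trans (_ : R^`(1) <*> 'C_R(A) \subset _).
    rewrite norm_joinEr; last by rewrite subIset ?(normal_norm nsR'R).
    by rewrite -quotientSK ?cRA ?(normal_norm nsR'R).
  by rewrite genS // setSU // (der1_sub_Phi _ _ _ pR).
by rewrite centsC -{1}(Phi_nongen defR) gen_subG subsetIr.
Qed.

(** By [cent_index9_der1] the Sylow subgroups of [N] for primes above 3 centralise [R], so
    [S * 'C_N(R)] contains a Sylow subgroup of [N] for every prime. *)
Lemma norm_odd_sylow_cent (gT : finGroupType) (R S N : {group gT}) :
    3.-group R -> #|R : R^`(1)| %| 9 -> odd #|N| -> N \subset 'N(R) ->
  3.-Sylow(N) S -> N \subset S * 'C_N(R).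
Proof.
move=> pR oRR' oddN nRN sylS; have sSN := pHall_sub sylS.
have nSC : S \subset 'N('C_N(R)).
  have [_ nC] := andP (subcent_normal N R); apply: subset_trans nC.
  by rewrite subsetI sSN (subset_trans sSN).
rewrite -norm_joinEl //; have sJN : S <*> 'C_N(R) \subset N.
  by rewrite join_subG sSN subsetIl.
rewrite -indexg_eq1 eqn_leq indexg_gt0 andbT leqNgt; apply/negP => /pdivP[r r_pr dv_r].
have dv_ind (A : {group gT}) : A \subset S <*> 'C_N(R) -> r %| #|N : A|.
  by move=> sAJ; apply: dvdn_trans dv_r _; rewrite indexgS.
have [eq_r3 | neq_r3] := eqVneq r 3.
  have [_ _ /pnatP p'ind] := and3P sylS.
  by have := p'ind (indexg_gt0 _ _) _ r_pr (dv_ind S (joing_subl _ _)); rewrite eq_r3.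
have [A sylA] := Sylow_exists r N; have [sAN rA /pnatP r'ind] := and3P sylA.
have: r \in r^'.
  apply: (r'ind (indexg_gt0 _ _) _ r_pr); apply: dv_ind.
  apply: subset_trans (joing_subr _ _); rewrite subsetI sAN.
  apply: (@cent_index9_der1 _ r) => //; last exact: subset_trans nRN.
  have odd_r : odd r by apply: dvdn_odd oddN; apply: dvdn_trans dv_r (dvdn_indexg _ _).
  by have := odd_prime_gt2 odd_r r_pr; rewrite leq_eqVlt eq_sym (negPf neq_r3).
by rewrite !inE eqxx.
Qed.

(** * Fixed points of 3-elements *)

Section Fixity.

Variables (gT : finGroupType) (rT : finType) (to : {action gT &-> rT}).
Variables (G P : {group gT}) (Omega : {set rT}).
Hypothesis trG : [transitive G, on Omega | to].
Hypothesis ffG : [faithful G, on Omega | to].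
Hypothesis fix4 : {in G^#, forall g, #|'Fix_(Omega | to)[g]| <= 4}.
Hypothesis oddG_ : {in Omega, forall a, odd #|'C_G[a | to]|}.
Hypothesis sylP : 3.-Sylow(G) P.

Local Notation Fix g := 'Fix_(Omega | to)[g].
Local Notation F0 := 'Fix_(Omega | to)(P).
Local Notation Delta := (\bigcup_(O in orbit to P @: Omega | #|O| <= 3) O).

Let pP : 3.-group P. Proof. exact: pHall_pgroup sylP. Qed.
Let sPG : P \subset G. Proof. exact: pHall_sub sylP. Qed.

Lemma act_Omega g a : g \in G -> (to a g \in Omega) = (a \in Omega).
Proof. by move=> Gg; rewrite (actsP (atrans_acts trG)). Qed.

Lemma mem_Fix g a : (a \in Fix g) = (a \in Omega) && (to a g == a).
Proof. by rewrite inE; congr (_ && _); apply: (sameP afix1P eqP). Qed.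

Lemma mem_FixJ g h a : h \in G -> (to a h \in Fix (g ^ h)) = (a \in Fix g).
Proof.
move=> Gh; rewrite !mem_Fix act_Omega // -actCJ.
by rewrite (inj_eq (act_inj to h)).
Qed.

Lemma card_FixJ g h : h \in G -> #|Fix (g ^ h)| = #|Fix g|.
Proof.
move=> Gh; rewrite -(card_imset (mem (Fix g)) (act_inj to h)); apply: eq_card => a.
apply/idP/imsetP=> [Fa | [b Fb ->]]; last by rewrite mem_FixJ.
by exists (to a h^-1); rewrite ?actKV // -(mem_FixJ g h) ?actKV.
Qed.

Lemma FixV g : Fix g^-1 = Fix g.
Proof.
apply/setP=> a; rewrite !mem_Fix; congr (_ && _).
by rewrite -(inj_eq (act_inj to g)) actKV eq_sym.
Qed.

Lemma sub_FixX g k : Fix g \subset Fix (g ^+ k).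
Proof.
apply/subsetP=> a; rewrite !mem_Fix => /andP[-> /eqP fixa].
apply/eqP; elim: k => [|k IHk]; first by rewrite act1.
by rewrite expgSr actM IHk.
Qed.

Lemma Fix_eq1 g : g \in G -> Fix g = Omega -> g = 1.
Proof.
move=> Gg eqF; apply/set1P/(subsetP ffG); rewrite inE Gg.
by apply/astabP=> a; rewrite -eqF mem_Fix => /andP[_ /eqP].
Qed.

Lemma stab_FixJ (S : {set rT}) g h : g \in G -> h \in G ->
  Fix g = S -> Fix (g ^ h) = S -> h \in 'N_G(S | to).
Proof.
move=> Gg Gh eqF eqFh; rewrite inE Gh !inE /=.
by apply/subsetP=> a; rewrite inE -{1}eqF -eqFh mem_FixJ.
Qed.

(** An involution on an odd set fixes a point, whose stabiliser would then have even order. *)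
Lemma no_involution_odd (S : {set rT}) t : S \subset Omega -> odd #|S| ->
  t \in 'N_G(S | to) -> #[t] = 2 -> False.
Proof.
move=> sSO oddS /setIP[Gt nSt] ot.
have p2 : 2.-group <[t]> by rewrite /pgroup -orderE ot.
have acts_t : [acts <[t]>, on S | to] by rewrite cycle_subG.
have := pgroup_fix_mod p2 acts_t; rewrite !modn2 oddS.
have [-> | [a]] := set_0Vmem 'Fix_(S | to)(<[t]>); first by rewrite cards0.
case/setIP=> Sa /afixP/(_ t (cycle_id t)) ta _.
have : #[t] %| #|'C_G[a | to]| by rewrite order_dvdG // inE Gt; apply/astab1P.
by move/dvdn_odd/(_ (oddG_ a (subsetP sSO a Sa))); rewrite ot.
Qed.

Lemma odd_no_involution (H : {group gT}) :
  (forall t, t \in H -> #[t] = 2 -> False) -> odd #|H|.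
Proof.
move=> noinv; apply: contraT; rewrite -dvdn2 => /Cauchy[] // t Ht ot.
by case: (noinv t Ht ot).
Qed.

Lemma fix_mod3 (A : {group gT}) :
  A \subset P -> #|Omega| = #|'Fix_(Omega | to)(A)| %[mod 3].
Proof.
move=> sAP; apply: pgroup_fix_mod; first exact: pgroupS pP.
by apply: subset_trans (atrans_acts trG); apply: subset_trans sPG.
Qed.

Lemma Fix_cycle g : 'Fix_(Omega | to)(<[g]>) = Fix g.
Proof. by rewrite afix_cycle. Qed.

Lemma sub_F0 g : g \in P -> F0 \subset Fix g.
Proof.
move=> Pg; apply/subsetP=> a /setIP[Oa /afixP Fa].
by rewrite mem_Fix Oa Fa ?eqxx.
Qed.

(** [Fix g] contains [F0], has at most 4 points, and both sizes are congruent to [#|Omega|] modulo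
    3. *)
Lemma small_or_big g : g \in P^# ->
  Fix g = F0 \/ #|Fix g| = #|F0| + 3 /\ #|F0| <= 1.
Proof.
case/setD1P=> ntg Pg; have Gg := subsetP sPG g Pg.
have le4 : #|Fix g| <= 4 by apply: fix4; rewrite !inE ntg.
have sF := sub_F0 g Pg; have leF := subset_leq_card sF.
have := fix_mod3 <[g]>%G; rewrite cycle_subG => /(_ Pg) /=.
rewrite (fix_mod3 P) // Fix_cycle.
have [eqF | neqF] := eqVneq F0 (Fix g); first by left.
have ltF : #|F0| < #|Fix g| by rewrite proper_card // properEneq neqF.
move: ltF le4; move: #|Fix g| #|F0| => m n lt_nm le_m4 /eqP eq_mod; right.
by move: m n lt_nm le_m4 eq_mod; do 5?[case=> //]; do 5?[case=> //].
Qed.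

(** * Short orbits and strong embedding *)

Lemma mem_Delta a :
  (a \in Delta) = (a \in Omega) && (#|P : 'C_P[a | to]| <= 3).
Proof.
rewrite -card_orbit; apply/bigcupP/andP=> [[_ /andP[/imsetP[b Ob ->] le3]] | [Oa le3]].
  move=> ba; rewrite (orbit_eqP ba); split=> //.
  by case/imsetP: ba => g Pg ->; rewrite act_Omega ?(subsetP sPG).
by exists (orbit to P a); rewrite ?orbit_refl // imset_f.
Qed.

Lemma P_norm_Delta : P \subset 'N(Delta | to).
Proof.
apply/subsetP=> g Pg; rewrite !inE; apply/subsetP=> a.
rewrite inE !mem_Delta act_Omega ?(subsetP sPG) // -!card_orbit => /andP[-> le3] /=.
by rewrite (orbit_eqP (mem_orbit to a Pg)).
Qed.

(** Elements of order 3 in [K :&: N] are conjugate there into [P :&: N], so their fixed set is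
    exactly [Delta]. If such an element stays in [K :&: N] after conjugation by [g^-1], then [g]
    maps [Delta] to itself. If [N] were inside [K], then [G], generated by [N] and [P], would
    stabilise [Delta]; so [Delta] would be [Omega], against faithfulness. *)
Lemma strongly_embedded_fix (N : {group gT}) :
    Delta != set0 -> N <| G -> 3.-nat #|G : N| -> P :&: N != 1 ->
    {in (P :&: N)^#, forall w, Fix w = Delta} ->
  strongly_embedded 3 ('N_G(Delta | to) :&: N)%G N.
Proof.
move=> /set0Pn[a Da] nsNG iN ntPN fixPN; have [sNG nNG] := andP nsNG.
set K := 'N_G(Delta | to)%G.
have sPK : P \subset K by rewrite subsetI sPG P_norm_Delta.
have sylPN : 3.-Sylow(N) (P :&: N) by rewrite setIC (Sylow_setI_normal nsNG).
have pPN : 3.-group (P :&: N) by apply: pgroupS pP; apply: subsetIl.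
have sDO : Delta \subset Omega by apply/subsetP=> b; rewrite mem_Delta => /andP[].
have [w PNw ntw] := trivgPn _ ntPN.
have Gw : w \in G by rewrite (subsetP sPG) //; case/setIP: PNw.
have fixw : Fix w = Delta by apply: fixPN; rewrite !inE ntw -in_setI.
have elt3 x : x \in K :&: N -> #[x] = 3 -> Fix x = Delta.
  case/setIP=> Kx Nx ox.
  have sylKN : 3.-Sylow(K :&: N) (P :&: N).
    by apply: pHall_subl sylPN; rewrite ?subsetIr // setSI.
  have [] := Sylow_Jsub sylKN (_ : <[x]> \subset K :&: N) _.
  - by rewrite cycle_subG inE Kx.
  - by rewrite /pgroup -orderE ox.
  move=> k /setIP[Kk _]; rewrite -cycleJ cycle_subG => PNxk.
  have [Gk nDk] := setIP Kk.
  have Fxk : Fix (x ^ k) = Delta.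
    by apply: fixPN; rewrite inE PNxk inE conjg_eq1 -order_gt1 ox.
  apply/setP=> b; rewrite -(mem_FixJ x k) // Fxk; exact: astabs_act.
split.
- rewrite properE subsetIr /= subsetI subxx andbT; apply/negP => sNK.
  have sGK : G \subset K.
    have <- : (N <*> P)%G = G.
      apply/group_inj/eqP; rewrite eqEsubset join_subG sNG sPG -indexg_eq1 /=.
      have: coprime #|G : N| #|G : P|.
        by apply: pnat_coprime iN _; case/and3P: sylP.
      rewrite -dvdn1 => /eqnP <-; rewrite dvdn_gcd !indexgS ?joing_subl ?joing_subr //.
    by rewrite join_subG sNK.
  have : Delta = Omega.
    apply/eqP; rewrite eqEsubset sDO /=.
    apply/subsetP=> b Ob; have [g Gg ->] := atransP2 trG (subsetP sDO a Da) Ob.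
    by rewrite (astabs_act _ (subsetP (subset_trans sGK (subsetIr _ _)) g Gg)).
  by rewrite -fixw => /(Fix_eq1 w Gw)/eqP; rewrite (negPf ntw).
- have : 3 %| #|P :&: N|.
    by have [] := pgroup_pdiv pPN ntPN.
  by move/dvdn_trans; apply; apply: cardSg; rewrite setSI.
move=> g /setDP[Ng nKg]; apply/negP => /Cauchy[] // x /setIP[KNx KNxg] ox.
have Gg := subsetP sNG g Ng; case/negP: nKg; rewrite inE Ng andbT.
move: KNxg; rewrite mem_conjg => KNx'.
have Gx : x ^ g^-1 \in G by case/setIP: KNx' => /setIP[].
apply: (stab_FixJ Delta (x ^ g^-1)) => //; last by rewrite conjgKV elt3.
by rewrite elt3 // orderJ.
Qed.

(** The fixed set of ['C_P[a | to]] properly contains [F0], so modulo 3 it has at least three more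
    points. It thus fills the fixed set of each nontrivial element of [P] fixing [a]. *)
Lemma big_TI w u a : w \in P^# -> u \in P^# -> a \in Fix w -> a \in Fix u ->
  a \notin F0 -> Fix w = Fix u.
Proof.
move=> Pw Pu Fwa Fua nF0a; have Oa : a \in Omega by case/setIP: Fwa.
pose A := 'C_P[a | to]%G; have sAP : A \subset P := subsetIl _ _.
have sFA v : v \in A -> 'Fix_(Omega | to)(A) \subset Fix v.
  by move=> Av; rewrite setIS // afixS // sub1set.
have sF0A : F0 \proper 'Fix_(Omega | to)(A).
  rewrite properE setIS ?afixS //=; apply: contra nF0a => /subsetP; apply.
  by rewrite inE Oa; apply/afixP=> v /setIP[_ /astab1P].
suffices FA v : v \in P^# -> a \in Fix v -> Fix v = 'Fix_(Omega | to)(A).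
  exact: etrans (FA w Pw Fwa) (esym (FA u Pu Fua)).
move=> Pv Fva; have [ntv Pv'] := setD1P Pv.
have Av : v \in A.
  by rewrite inE Pv'; apply/astab1P; move: Fva; rewrite mem_Fix => /andP[_ /eqP].
have [eqF | [cardF le1]] := small_or_big v Pv; first by rewrite -eqF Fva in nF0a.
apply/esym/eqP; rewrite eqEcard sFA //= cardF.
have lt_F := proper_card sF0A; rewrite leqNgt -ltn_subLR; last exact: ltnW.
apply/negP => lt3; have /eqP := fix_mod3 A sAP.
rewrite (fix_mod3 P) // eq_sym eqn_mod_dvd ?(ltnW lt_F) //.
by apply/negP; rewrite gtnNdvd ?subn_gt0.
Qed.

(** As [#|P| >= 9], a point in a [P]-orbit of length at most 3 is fixed by a nontrivial element of
    [P], hence lies in [F0]. *)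
Lemma strongly_embedded_small : 9 <= #|P| -> F0 != set0 ->
    {in P^#, forall w, Fix w = F0} ->
  Delta = F0 /\ strongly_embedded 3 ('N_G(Delta | to) :&: G)%G G.
Proof.
move=> P9 ntF0 fixP.
have defD : Delta = F0.
  apply/setP=> a; rewrite mem_Delta [in RHS]inE; have [Oa /= | //] := boolP (a \in Omega).
  apply/idP/afixP=> [le3 g Pg | fixa].
    have : 'C_P[a | to] != 1.
      apply: contraTneq le3 => ->; rewrite indexg1 -ltnNge; exact: leq_trans P9.
    case/trivgPn=> v /setIP[Pv /astab1P va] ntv.
    have : a \in Fix v by rewrite mem_Fix Oa va eqxx.
    rewrite fixP; last by rewrite !inE ntv.
    by case/setIP=> _ /afixP->.
  suffices -> : 'C_P[a | to] = P by rewrite indexgg.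
  by apply/setIidPl/subsetP=> g Pg; apply/astab1P/fixa.
split=> //; apply: strongly_embedded_fix; rewrite ?defD ?normal_refl ?indexgg //.
  rewrite (setIidPl sPG); apply: contraTneq P9 => ->; by rewrite cards1.
by rewrite (setIidPl sPG).
Qed.

(** * Big elements in the centre of P *)

(** [P] centralises [z], so it permutes the three points of [Fix z] outside [F0]; [big_TI]
    identifies the stabiliser of one of them. *)
Lemma big_stab_index z : z \in 'Z(P)^# -> Fix z != F0 ->
  exists Q : {group gT}, [/\ Q <| P, #|P : Q| = 3
    & {in P^#, forall u, (u \in Q) = (Fix u == Fix z)}].
Proof.
case/setD1P=> ntz Zz bigz; have [Pz cPz] := setIP Zz.
have Pz1 : z \in P^# by rewrite !inE ntz.
have [eqF | [cardF le1]] := small_or_big z Pz1; first by rewrite eqF eqxx in bigz.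
have sF := sub_F0 z Pz.
have [b Fzb nF0b] : exists2 b, b \in Fix z & b \notin F0.
  by apply/subsetPn; apply: contra bigz => sFz; rewrite eqEsubset sFz.
have cardD : #|Fix z :\: F0| = 3.
  by rewrite cardsD (setIidPr sF) cardF addKn.
pose Q := 'C_P[b | to]%G.
have iQ : #|P : Q| = 3.
  have le3 : #|P : Q| <= 3.
    rewrite -card_orbit -cardD subset_leq_card //; apply/subsetP=> _ /imsetP[g Pg ->].
    have zg : z ^ g = z by rewrite conjgE (centP cPz g Pg) mulKg.
    rewrite inE -{1}zg mem_FixJ ?(subsetP sPG) // Fzb andbT.
    apply: contra nF0b => /setIP[Ob /afixP fixb].
    rewrite inE -(act_Omega g) ?(subsetP sPG) // Ob.
    apply/afixP=> h Ph; apply: (act_inj to g).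
    by rewrite actCJ fixb ?groupJ.
  have nt : #|P : Q| != 1%N.
    rewrite indexg_eq1; apply: contra nF0b => /subsetP sPQ.
    rewrite inE; case/setIP: (Fzb) => -> _; apply/afixP=> g Pg.
    by have /setIP[_ /astab1P] := sPQ g Pg.
  have := pnat_dvd (dvdn_indexg P Q) pP.
  by move: #|P : Q| le3 nt => [|[|[|[|]]]].
exists Q; split=> //.
  by apply: (p_maximal_normal pP); apply: p_index_maximal; rewrite ?iQ ?subsetIl.
move=> u Pu1; have [ntu Pu] := setD1P Pu1; apply/idP/eqP => [Qu | eqF].
  apply: (big_TI u z b) => //; case/setIP: Qu => _ /astab1P ub.
  by rewrite mem_Fix ub eqxx; case/setIP: Fzb => ->.
by move: Fzb; rewrite -eqF mem_Fix inE Pu => /andP[_ /eqP ub]; apply/astab1P.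
Qed.

Section CentralBig.

Variables (z : gT) (Q : {group gT}).
Hypothesis Zz : z \in 'Z(P)^#.
Hypothesis bigz : Fix z != F0.
Hypotheses (nsQP : Q <| P) (iQ : #|P : Q| = 3).
Hypothesis mem_Q : {in P^#, forall u, (u \in Q) = (Fix u == Fix z)}.

Let Pz : z \in P. Proof. by case/setD1P: Zz => _ /setIP[]. Qed.
Let Pz1 : z \in P^#. Proof. by rewrite !inE Pz; case/setD1P: Zz => ->. Qed.
Let Qz : z \in Q. Proof. by rewrite mem_Q. Qed.
Let sQP : Q \subset P. Proof. exact: normal_sub. Qed.
Let cardz : #|Fix z| = #|F0| + 3 /\ #|F0| <= 1.
Proof. by case: (small_or_big z Pz1) bigz => [->|//]; rewrite eqxx. Qed.

Lemma Fix_Q : {in Q^#, forall u, Fix u = Fix z}.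
Proof.
move=> u /setD1P[ntu Qu]; apply/eqP; rewrite -mem_Q //.
by rewrite !inE ntu (subsetP sQP).
Qed.

Lemma index3_meet (R : {group gT}) :
  R \subset P -> ~~ (R \subset Q) -> #|R : R :&: Q| = 3.
Proof.
move=> sRP nsRQ; have nQR := subset_trans sRP (normal_norm nsQP).
apply/(prime_nt_dvdP (isT : prime 3)); first by rewrite indexg_eq1 subsetI subxx.
rewrite -indexgI setIA setIid indexgI -iQ -(card_quotient nQR).
by rewrite -(card_quotient (normal_norm nsQP)) cardSg ?quotientS.
Qed.

(** A nontrivial element of [Q] fixing [a] would share its fixed set with [y] by [big_TI], putting
    [y] in [Q]. So the stabiliser embeds in [P / Q]. *)
Lemma big_stab_le3 y a : y \in P -> y \notin Q -> a \in Fix y -> a \notin F0 ->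
  #|'C_P[a | to]| <= 3 /\ 'C_P[a | to] :&: Q = 1.
Proof.
move=> Py nQy Fya nF0a; have nty : y != 1 by apply: contraNneq nQy => ->.
have tiQ : 'C_P[a | to] :&: Q = 1.
  apply/trivgP/subsetP=> u /setIP[/setIP[Pu /astab1P ua] Qu]; apply: contraT => ntu.
  rewrite inE in ntu; case/negP: nQy; rewrite mem_Q ?inE ?nty //.
  rewrite -(Fix_Q u) ?inE ?ntu //; apply/eqP; apply: (big_TI _ _ a) => //.
  - by rewrite !inE nty.
  - by rewrite !inE ntu.
  by case/setIP: Fya => Oa _; rewrite mem_Fix Oa ua eqxx.
split=> //; have [sCQ | nsCQ] := boolP ('C_P[a | to] \subset Q).
  by rewrite -(setIidPl sCQ) tiQ cards1.
have := index3_meet 'C_P[a | to]%G (subsetIl _ _) nsCQ.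
by rewrite /= tiQ indexg1 => ->.
Qed.

Lemma big_order3 y : y \in P -> y \notin Q -> Fix y != F0 -> #[y] = 3.
Proof.
move=> Py nQy bigy; have nty : y != 1 by apply: contraNneq nQy => ->.
have Py1 : y \in P^# by rewrite !inE nty.
have [a Fya nF0a] : exists2 a, a \in Fix y & a \notin F0.
  by apply/subsetPn; apply: contra bigy => sFy; rewrite eqEsubset sFy sub_F0.
have [le3 _] := big_stab_le3 y a Py nQy Fya nF0a.
have : #[y] <= 3.
  apply: leq_trans le3; rewrite orderE subset_leq_card // cycle_subG inE Py.
  by apply/astab1P; move: Fya; rewrite mem_Fix => /andP[_ /eqP].
have := mem_p_elt pP Py; rewrite /p_elt.
by move: nty; rewrite -order_gt1; move: #[y] => [|[|[|[|]]]].
Qed.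

Lemma abelem9_of_big y : y \in P -> y \notin Q -> Fix y != F0 -> #|P| = 9 ->
  3.-abelem P.
Proof.
move=> Py nQy bigy oP; have oy := big_order3 y Py nQy bigy.
have abP : abelian P by apply: (p2group_abelian pP); rewrite oP.
have abO := Ohm1_abelem pP abP; suffices <- : 'Ohm_1(P) = P by [].
apply/eqP; rewrite eqEcard Ohm_sub oP leqNgt; apply/negP => lt9.
have Oy : y \in 'Ohm_1(P) by rewrite (OhmE 1 pP) mem_gen // !inE Py -oy expg_order eqxx.
have oQ : #|Q| = 3 by apply/eqP; rewrite -(eqn_pmul2r (isT : 0 < 3)) -{1}iQ Lagrange ?oP.
have Oz : z \in 'Ohm_1(P).
  by rewrite (OhmE 1 pP) mem_gen // !inE Pz -{1}oQ expg_cardG ?eqxx.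
have: 'Ohm_1(P) :&: Q \proper 'Ohm_1(P).
  by rewrite properE subsetIl subsetI subxx; apply: contra nQy => /subsetP; apply.
have : 1 < #|'Ohm_1(P) :&: Q|.
  by rewrite cardG_gt1; apply/trivgPn; exists z; rewrite ?inE ?Oz //; case/setD1P: Zz.
have := index3_meet 'Ohm_1(P)%G (Ohm_sub 1 P).
have -> : ~~ ('Ohm_1(P) \subset Q) by apply: contra nQy => /subsetP; apply.
move=> /(_ isT) iO gt1 _.
have := Lagrange (subsetIl 'Ohm_1(P) Q); rewrite iO => oO.
have : #|'Ohm_1(P) :&: Q| %| 3 by rewrite -oQ cardSg ?subsetIr.
by move/(prime_nt_dvdP (isT : prime 3)) => o3; rewrite -oO o3 // gtn_eqF in lt9.
Qed.

End CentralBig.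

Lemma mem_astabs (S : {set rT}) n :
  n \in G -> {in S, forall a, to a n \in S} -> n \in 'N_G(S | to).
Proof. by move=> Gn nSn; rewrite inE Gn !inE; apply/subsetP=> a /nSn; rewrite inE. Qed.

Lemma norm_FixG (R : {group gT}) n :
  n \in 'N_G(R) -> n \in 'N_G('Fix_(Omega | to)(R) | to).
Proof.
case/setIP=> Gn nRn; apply: mem_astabs => // a.
case/setIP=> Oa /afixP fixa; rewrite inE act_Omega // Oa.
apply/afixP=> r Rr; have Rrn : r ^ n^-1 \in R by rewrite memJ_norm ?groupV.
by rewrite -[r](conjgKV n) -actCJ fixa.
Qed.

(** * Local fusion for subgroups not contained in [Q] *)

Section CentralBigFusion.

Variables (z : gT) (Q : {group gT}).
Hypothesis Zz : z \in 'Z(P)^#.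
Hypothesis bigz : Fix z != F0.
Hypotheses (nsQP : Q <| P) (iQ : #|P : Q| = 3).
Hypothesis mem_Q : {in P^#, forall u, (u \in Q) = (Fix u == Fix z)}.
Hypothesis no_big9 : #|P| = 9 -> {in P :\: Q, forall y, Fix y = F0}.

Let Pz : z \in P. Proof. by case/setD1P: Zz => _ /setIP[]. Qed.
Let ntz : z != 1. Proof. by case/setD1P: Zz. Qed.
Let Pz1 : z \in P^#. Proof. by rewrite !inE Pz ntz. Qed.
Let Qz : z \in Q. Proof. by rewrite mem_Q. Qed.
Let sQP : Q \subset P. Proof. exact: normal_sub. Qed.
Let cardz : #|Fix z| = #|F0| + 3 /\ #|F0| <= 1.
Proof. by case: (small_or_big z Pz1) bigz => [->|//]; rewrite eqxx. Qed.
Let FixQ : {in Q^#, forall u, Fix u = Fix z} := Fix_Q z Q nsQP mem_Q.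
Let F0_sub : F0 \subset Fix z. Proof. exact: sub_F0. Qed.
Let sFO g : Fix g \subset Omega. Proof. exact: subsetIl. Qed.

Variable R : {group gT}.
Hypotheses (sRP : R \subset P) (cRR : 'C_P(R) \subset R) (nsRQ : ~~ (R \subset Q)).
Hypothesis sylNR : 3.-Sylow('N_G(R)) 'N_P(R).

Let Rz : z \in R.
Proof.
apply: (subsetP cRR); case/setD1P: Zz => _ /setIP[_ cPz].
by rewrite inE Pz (subsetP (centS sRP)).
Qed.

Let FixR : 'Fix_(Omega | to)(R) = F0.
Proof.
have [r Rr nQr] := subsetPn nsRQ.
have sF0R : F0 \subset 'Fix_(Omega | to)(R) by rewrite setIS ?afixS.
apply/eqP; rewrite eqEsubset sF0R andbT.
apply/subsetP=> a /setIP[Oa /afixP fixa]; apply: contraT => nF0a.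
have ntr : r != 1 by apply: contraNneq nQr => ->.
have Pr1 : r \in P^# by rewrite !inE ntr (subsetP sRP).
case/negP: nQr; rewrite mem_Q //; apply/eqP.
by apply: (big_TI _ _ a); rewrite // mem_Fix Oa fixa ?eqxx.
Qed.

Let norm_F0 n : n \in 'N_G(R) -> n \in 'N_G(F0 | to).
Proof. by rewrite -FixR; apply: norm_FixG. Qed.

(* An element moving R :&: Q forces R to be elementary abelian of order 9     *)
(* with all its nontrivial elements conjugate in G to elements of Q; then     *)
(* N_G(R) has odd order, and is N_P(R) C_G(R), which centralises z.           *)
Let norm_RQ n : n \in 'N_G(R) -> n \in 'N(R :&: Q).
Proof.
move=> Nn; have [Gn nRn] := setIP Nn.
have [sRQn | /subsetPn[_ /imsetP[q RQq ->] nQy]] := boolP ((R :&: Q) :^ n \subset Q).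
  have sRn : (R :&: Q) :^ n \subset R.
    by have := subsetIl R Q; rewrite -(conjSg _ _ n) (normP nRn).
  by rewrite inE subsetI sRn.
have [Rq Qq] := setIP RQq; set y := q ^ n in nQy.
have Ry : y \in R by rewrite memJ_norm.
have Py := subsetP sRP y Ry; have nty : y != 1 by apply: contraNneq nQy => ->.
have Py1 : y \in P^# by rewrite !inE nty.
have ntq : q != 1 by rewrite -(conjg_eq1 q n).
have cardy : #|Fix y| = #|F0| + 3.
  by rewrite card_FixJ // FixQ ?inE ?ntq //; case: cardz.
have bigy : Fix y != F0.
  apply/eqP => /(congr1 (fun A : {set rT} => #|A|)) /eqP.
  by rewrite cardy -{2}[#|F0|]addn0 eqn_add2l.
have [a Fya nF0a] : exists2 a, a \in Fix y & a \notin F0.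
  by apply/subsetPn; apply: contra bigy => sFy; rewrite eqEsubset sFy sub_F0.
have [le3 tiQ] := big_stab_le3 z Q nsQP iQ mem_Q y a Py nQy Fya nF0a.
have oS : #|R :&: Q| = 3.
  have sSC : (R :&: Q) :^ n \subset 'C_P[a | to].
    apply/subsetP=> _ /imsetP[s /setIP[Rs Qs] ->].
    apply/setIP; split; first by rewrite (subsetP sRP) ?memJ_norm.
    apply/astab1P.
    have [-> | nts] := eqVneq s 1; first by rewrite conj1g act1.
    suffices : a \in Fix (s ^ n) by rewrite mem_Fix => /andP[_ /eqP].
    move: Fya; rewrite -[a](actKV to n) /y !mem_FixJ //.
    by rewrite !FixQ ?inE ?nts ?ntq.
  have : #|R :&: Q| <= 3 by rewrite -(cardJg _ n) (leq_trans _ le3) ?subset_leq_card.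
  have : 1 < #|R :&: Q| by rewrite cardG_gt1; apply/trivgPn; exists z; rewrite ?inE ?Rz.
  have := pgroupS (subset_trans (subsetIl R Q) sRP) pP; rewrite /pgroup.
  by move: #|R :&: Q| => [|[|[|[|]]]].
have oR : #|R| = 9.
  by rewrite -(Lagrange (subsetIl R Q)) oS (index3_meet Q nsQP iQ).
have abR : abelian R by apply: (p2group_abelian (pgroupS sRP pP)); rewrite oR.
have ltRP : R \proper P.
  rewrite properEneq sRP andbT; apply: contra_neq bigy => eqRP.
  by apply: no_big9; rewrite -?eqRP // inE nQy eqRP.
have := nilpotent_proper_norm (pgroup_nil pP) ltRP.
case/properP=> _ [u /setIP[Pu nRu] nRu'].
have oz : <[z]> = R :&: Q.
  apply/eqP; rewrite eqEcard cycle_subG inE Rz Qz oS -orderE /=.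
  have : 1 < #[z] by rewrite order_gt1.
  have := mem_p_elt pP Pz; rewrite /p_elt; by move: #[z] => [|[|[|]]].
have nCRu : y ^ u != y.
  apply: contra nRu' => /eqP yu; apply: (subsetP cRR); rewrite inE Pu.
  suffices defR : 'C_R[u] = R by rewrite -sub_cent1 -defR subsetIr.
  apply/eqP; rewrite eqEcard subsetIl oR.
  have : 3 < #|'C_R[u]|.
    rewrite -oS proper_card // properE; apply/andP; split.
      rewrite -oz cycle_subG inE Rz; apply/cent1P.
      by case/setD1P: Zz => _ /setIP[_ /centP/(_ u Pu)].
    have Cy : y \in 'C_R[u] by rewrite inE Ry; apply/cent1P/commgP/conjg_fixP.
    by apply: contra nQy => /subsetP/(_ y Cy)/setIP[].
  have := cardSg (subsetIl R 'C[u]); rewrite oR.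
  by move: #|_| => k; move: k; do 10?[case=> //].
(* The class lies in this coset of size 3 because [P / Q] is abelian, and fills it because its size
   is a power of 3 above 1. *)
have classy : y *: (R :&: Q) \subset y ^: 'N_P(R).
  have sub : y ^: 'N_P(R) \subset y *: (R :&: Q).
    apply/subsetP=> _ /imsetP[g /setIP[Pg nRg] ->].
    rewrite mem_lcoset inE groupM ?groupV ?memJ_norm //= -commgEl.
    apply: (subsetP (der1_min (normal_norm nsQP) _)); last exact: mem_commg.
    by rewrite cyclic_abelian // prime_cyclic // card_quotient ?normal_norm ?iQ.
  suffices ge3 : 3 <= #|y ^: 'N_P(R)|.
    by have /eqP -> : y ^: 'N_P(R) == y *: (R :&: Q) by rewrite eqEcard sub card_lcoset oS.
  have p3 : 3.-nat #|y ^: 'N_P(R)|.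
    by rewrite -index_cent1; apply: pnat_dvd (dvdn_indexg _ _) (pgroupS (subsetIl _ _) pP).
  have : 1 < #|y ^: 'N_P(R)|.
    apply/card_gt1P; exists y, (y ^ u); rewrite class_refl eq_sym nCRu; split=> //.
    by rewrite memJ_class // inE Pu.
  by move: #|_| p3 => [|[|[|]]].
have allbig w : w \in R^# -> #|Fix w| = #|F0| + 3.
  case/setD1P=> ntw Rw; have [Qw | nQw] := boolP (w \in Q).
    by rewrite FixQ ?inE ?ntw //; case: cardz.
  have yS v : v \in y *: (R :&: Q) -> #|Fix v| = #|F0| + 3.
    move/(subsetP classy)=> /imsetP[g /setIP[Pg _] ->].
    by rewrite card_FixJ ?(subsetP sPG).
  have nsRQR : R :&: Q <| R.
    by rewrite /normal subsetIl normsI ?normG // (subset_trans sRP) ?normal_norm.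
  have /orP[Sw | Sw] : (y^-1 * w \in R :&: Q) || (y * w \in R :&: Q).
    apply: (@index3_coset _ R (R :&: Q)%G) => //;
      rewrite ?inE ?negb_and ?nQy ?nQw ?orbT ?Ry //.
    exact: (index3_meet Q nsQP iQ).
  - by apply: yS; rewrite mem_lcoset.
  rewrite -FixV; apply: yS; rewrite mem_lcoset -groupV invMg !invgK.
  by rewrite (centsP abR w).
have oddN : odd #|'N_G(R)|.
  apply: (odd_no_involution) => t Nt ot; have [Gt nRt] := setIP Nt.
  have [F0eq0 | nt0] := eqVneq #|F0| 0; last first.
    have F01 : #|F0| = 1%N by apply/eqP; rewrite eqn_leq (proj2 cardz) lt0n.
    by apply: (no_involution_odd F0 t) (norm_F0 t Nt) ot; rewrite ?subsetIl // F01.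
  have odd_big w : w \in R^# -> t \in 'N_G(Fix w | to) -> False.
    move=> Rw nFt; apply: (no_involution_odd (Fix w) t) nFt ot => //.
    by rewrite allbig ?F0eq0.
  have tt : t * t = 1 by have := expg_order t; rewrite ot expgS expg1.
  have Gw w : w \in R^# -> w \in G.
    by case/setD1P=> _ Rw; rewrite (subsetP sPG) ?(subsetP sRP).
  (* Here [F0] is empty, so nontrivial elements of [R] fix three points. Either [t] inverts [z], or
     it centralises the nontrivial element [z * z ^ t]; both ways it preserves a set of three
     points. *)
  have [b1 | ntb] := eqVneq (z * z ^ t) 1.
    apply: (odd_big z); first by rewrite !inE ntz.
    apply: (stab_FixJ _ z) => //; first by rewrite (subsetP sPG).
    by rewrite -(mulKg z (z ^ t)) b1 mulg1 FixV.
  have Rb : z * z ^ t \in R^# by rewrite !inE ntb groupM // memJ_norm.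
  apply: (odd_big _ Rb); apply: (stab_FixJ _ (z * z ^ t)) => //; first exact: Gw.
  rewrite conjMg -conjgM tt conjg1; congr (Fix _).
  by apply: (centsP abR); rewrite ?memJ_norm.
have pR := pgroupS sRP pP.
have iR9 : #|R : R^`(1)| %| 9 by rewrite -oR dvdn_indexg.
have := norm_odd_sylow_cent _ R _ 'N_G(R)%G pR iR9 oddN (subsetIr _ _) sylNR.
case/subsetP/(_ n Nn)/mulsgP=> p c /setIP[Pp _] /setIP[_ cRc] def_n.
case/negP: nQy; have zq : q \in <[z]> by rewrite oz.
have -> : y = q.
  rewrite /y def_n conjgM.
  have -> : q ^ p = q.
    have /cycleP[i ->] := zq; rewrite conjXg; congr (_ ^+ _).
    by case/setD1P: Zz => _ /setIP[_ cPz]; rewrite conjgE (centP cPz p Pp) mulKg.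
  by rewrite conjgE -(centP cRc q Rq) mulKg.
by [].
Qed.

(** By [norm_RQ] an involution in ['N_G(R)] would send [z] into [Q], so it would preserve [Fix z] as
    well as [F0], and hence a set of three points. So ['N_G(R)] has odd order and [odd_norm_index3]
    applies to [R :&: Q]. *)
Lemma central_big_local : {in 'N_G(R) & R, forall n r, r^-1 * r ^ n \in Q}.
Proof.
have nsW : R :&: Q <| R.
  by rewrite /normal subsetIl normsI ?normG // (subset_trans sRP) ?normal_norm.
have oddN : odd #|'N_G(R)|.
  apply: odd_no_involution => t Nt ot; have [Gt nRt] := setIP Nt.
  have nF0t := norm_F0 t Nt; have nRQt := norm_RQ t Nt.
  apply: (no_involution_odd (Fix z :\: F0) t) ot.
  - by rewrite (subset_trans (subsetDl _ _)).
  - by rewrite cardsD (setIidPr F0_sub) (proj1 cardz) addKn.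
  have Qzt : z ^ t \in Q^#.
    by have := memJ_norm z nRQt; rewrite !inE conjg_eq1 ntz Rz Qz => /andP[].
  have nFzt : t \in 'N_G(Fix z | to).
    by apply: (stab_FixJ _ z) => //; [rewrite (subsetP sPG) | rewrite FixQ].
  apply: mem_astabs => // a /setDP[Fza nF0a]; rewrite inE.
  case/setIP: nFzt nF0t => _ nFzt /setIP[_ nF0t].
  by rewrite (astabs_act _ nFzt) Fza (astabs_act _ nF0t) nF0a.
move=> n r Nn Rr; have [Gn nRn] := setIP Nn.
have odd_n : odd #[n] by apply: dvdn_odd oddN; rewrite order_dvdG.
have iRQ := index3_meet Q nsQP iQ R sRP nsRQ.
have := odd_norm_index3 _ R (R :&: Q)%G n nsW iRQ nRn (norm_RQ n Nn) odd_n r Rr.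
by case/setIP.
Qed.

End CentralBigFusion.

Lemma setI_neq1_index (N : {group gT}) :
  N <| G -> #|G : N| < #|P| -> P :&: N != 1.
Proof.
case/andP=> sNG nNG; apply: contraTneq => tiPN; rewrite -leqNgt.
have nNP := subset_trans sPG nNG.
rewrite (card_isog (quotient_isog nNP _)) ?(setIC N) // -card_quotient //.
by rewrite subset_leq_card ?quotientS.
Qed.

(** Transfer to [P / Q] gives [N] with [P :&: N] inside [Q], whose nontrivial elements all have the
    fixed set [Fix z], and this set is [Delta]. Excluding the elementary abelian group of order 9
    rules out big elements outside [Q] when [#|P| = 9]. *)
Lemma central_big_strongly_embedded z : z \in 'Z(P)^# -> Fix z != F0 -> 9 <= #|P| ->
    (#|P| = 9 -> ~~ 3.-abelem P) ->
  exists N : {group gT}, [/\ N <| G, #|G : N| %| 3,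
    strongly_embedded 3 ('N_G(Delta | to) :&: N)%G N & 1 <= #|Delta| <= 4].
Proof.
move=> Zz bigz P9 nabP; have [Q [nsQP iQ mem_Q]] := big_stab_index z Zz bigz.
have [ntz /setIP[Pz _]] := setD1P Zz; have Pz1 : z \in P^# by rewrite !inE ntz.
have [eqF | [cardz le1]] := small_or_big z Pz1; first by rewrite eqF eqxx in bigz.
have no_big9 : #|P| = 9 -> {in P :\: Q, forall y, Fix y = F0}.
  move=> oP y /setDP[Py nQy]; apply/eqP; apply: contraT => bigy.
  by case/negP: (nabP oP); apply: (abelem9_of_big z Q Zz nsQP iQ mem_Q y).
have Qz : z \in Q by rewrite mem_Q.
have fixQ := Fix_Q z Q nsQP mem_Q.
have defD : Delta = Fix z.
  apply/setP=> a; rewrite mem_Delta; have [Oa /= | nOa] := boolP (a \in Omega); last first.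
    by apply/esym/negbTE; apply: contra nOa => /setIP[].
  have [F0a | nF0a] := boolP (a \in F0).
    rewrite (subsetP (sub_F0 z Pz)) //; suffices -> : 'C_P[a | to] = P by rewrite indexgg.
    apply/setIidPl/subsetP=> g Pg; apply/astab1P.
    by case/setIP: F0a => _ /afixP->.
  apply/idP/idP => [le3 | Fza]; last first.
    have sQC : Q \subset 'C_P[a | to].
      apply/subsetP=> u Qu; apply/setIP; split; first exact: (subsetP (normal_sub nsQP)).
      apply/astab1P; have [-> | ntu] := eqVneq u 1; first by rewrite act1.
      have Qu1 : u \in Q^# by rewrite !inE ntu.
      by move: Fza; rewrite -(fixQ u Qu1) mem_Fix => /andP[_ /eqP].
    by rewrite -iQ dvdn_leq ?indexgS // indexg_gt0.
  have ntC : 'C_P[a | to] != 1.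
    by apply: contraTneq le3 => ->; rewrite indexg1 -ltnNge (leq_trans _ P9).
  have [u /setIP[Pu /astab1P ua] ntu] := trivgPn _ ntC.
  have Fua : a \in Fix u by rewrite mem_Fix Oa ua eqxx.
  have [Qu | nQu] := boolP (u \in Q); first by rewrite -(fixQ u) // !inE ntu.
  have [leC _] := big_stab_le3 z Q nsQP iQ mem_Q u a Pu nQu Fua nF0a.
  have oP : #|P| = 9.
    apply/eqP; rewrite eqn_leq P9 andbT -(Lagrange (subsetIl P 'C[a | to])).
    exact: leq_mul leC le3.
  have PQu : u \in P :\: Q by apply/setDP.
  by move: Fua; rewrite (no_big9 oP u PQu) (negPf nF0a).
have locQ (R : {group gT}) : R \subset P -> 'C_P(R) \subset R ->
    3.-Sylow('N_G(R)) 'N_P(R) ->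
    {in 'N_G(R) & R :&: [set: gT], forall n r, r^-1 * r ^ n \in Q}.
  move=> sRP cRR sylN n r Nn; rewrite setIT => Rr.
  have [sRQ | nsRQ] := boolP (R \subset Q).
    rewrite groupM ?groupV ?(subsetP sRQ) // memJ_norm //.
    by case/setIP: Nn.
  exact: (central_big_local z Q Zz bigz nsQP iQ mem_Q no_big9 R).
have nGT : G \subset 'N([set: gT]) by rewrite normsG ?subsetT.
have fus := local_fusion _ _ _ _ sylP _ Q nGT locQ.
have abPQ : abelian (P / Q).
  by rewrite cyclic_abelian // prime_cyclic // card_quotient ?normal_norm ?iQ.
have [|N nsNG [iN]] := transfer_kernel _ _ _ _ Q _ sylP nsQP abPQ _ fus.
  by move=> *; rewrite inE.
rewrite setIT iQ in iN * => sPNQ; exists N; split=> //.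
  apply: strongly_embedded_fix => //.
  - by rewrite defD -card_gt0 cardz addnC.
  - by apply: pnat_dvd iN _.
  - apply: setI_neq1_index => //; apply: leq_trans P9.
    by rewrite ltnS (leq_trans (dvdn_leq _ iN)).
  move=> w /setD1P[ntw PNw]; rewrite defD; apply: fixQ.
  by rewrite !inE ntw (subsetP sPNQ).
by rewrite defD cardz; case: #|F0| le1 => [|[|]].
Qed.

(** * No big elements in the centre of P *)

Section NoCentralBig.

Hypothesis smallZ : {in 'Z(P)^#, forall z, Fix z = F0}.

(** Let [Q] be the stabiliser of [b] in [P] and [M] its normaliser. [M] permutes the three points of
    [Fix x] outside [F0], so [#|M : Q| = 3]. Central elements are small, so [Q] meets ['Z(P)]
    trivially, which forces [M = Q * 'Z(P)] and [M] proper in [P]. An element of ['N_P(M)] outside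
    [M] moves [Q] to a subgroup of [M] meeting [Q] trivially, hence [#|Q| <= 3]. *)
Lemma noncentral_big_stab x b : x \in P^# -> Fix x != F0 ->
  b \in Fix x -> b \notin F0 ->
  [/\ #|'C_P[b | to]| = 3, #|'Z(P)| = 3, #|P| >= 27,
      'C_P[b | to] = <[x]> & 'C_P[x] = <[x]> * 'Z(P) /\ #|'C_P[x]| = 9].
Proof.
move=> Px1 bigx Fxb nF0b; have [ntx Px] := setD1P Px1.
have cardx : #|Fix x| = #|F0| + 3 /\ #|F0| <= 1.
  by case: (small_or_big x Px1) bigx => [->|//]; rewrite eqxx.
have Ob : b \in Omega by case/setIP: Fxb.
set Q := 'C_P[b | to]%G; have sQP : Q \subset P := subsetIl _ _.
have Qx : x \in Q.
  apply/setIP; split=> //; apply/astab1P.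
  by move: Fxb; rewrite mem_Fix => /andP[_ /eqP].
have FixQ u : u \in Q^# -> Fix u = Fix x.
  case/setD1P=> ntu /setIP[Pu /astab1P ub]; apply: (big_TI u x b) => //.
    by rewrite !inE ntu.
  by rewrite mem_Fix Ob ub eqxx.
have memQ u : u \in P -> b \in Fix u -> u \in Q.
  by move=> Pu; rewrite mem_Fix => /andP[_ /eqP ub]; apply/setIP; split=> //; apply/astab1P.
have ltQP : Q \proper P.
  rewrite properE sQP; apply: contra nF0b => /subsetP sPQ; rewrite inE Ob.
  by apply/afixP=> g /sPQ/setIP[_ /astab1P].
set M := 'N_P(Q)%G; have sMP : M \subset P := subsetIl _ _.
have ltQM : Q \proper M := nilpotent_proper_norm (pgroup_nil pP) ltQP.
have iM : #|M : Q| = 3.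
  have le3 : #|M : Q| <= 3.
    have -> : Q = 'C_M[b | to]%G.
      apply/group_inj/eqP; rewrite eqEsubset /= subsetI (proper_sub ltQM) subsetIr /=.
      by rewrite setSI.
    rewrite -card_orbit.
    have <- : #|Fix x :\: F0| = 3.
      by rewrite cardsD (setIidPr (sub_F0 x Px)) (proj1 cardx) addKn.
    apply/subset_leq_card/subsetP=> _ /imsetP[g /setIP[Pg nQg] ->].
    have Gg := subsetP sPG g Pg.
    have Qxg : x ^ g \in Q^# by apply/setD1P; rewrite conjg_eq1 memJ_norm.
    apply/setDP; split; first by rewrite -(FixQ _ Qxg) mem_FixJ.
    apply: contra nF0b => /setIP[_ /afixP fixb]; rewrite inE Ob.
    apply/afixP=> h Ph; apply: (act_inj to g).
    by rewrite actCJ fixb ?groupJ.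
  have nt : #|M : Q| != 1%N by rewrite indexg_eq1 proper_subn.
  have := pnat_dvd (dvdn_indexg M Q) (pgroupS sMP pP).
  by case: #|M : Q| le3 nt => [|[|[|[|]]]].
have tiQZ : Q :&: 'Z(P) = 1.
  apply/trivgP/subsetP=> u /setIP[Qu Zu]; rewrite inE; apply: contraT => ntu.
  have Qu1 : u \in Q^# by apply/setD1P.
  case/negP: bigx; rewrite -(FixQ u Qu1); apply/eqP/smallZ.
  by apply/setD1P.
have nQZ : 'Z(P) \subset 'N(Q).
  by rewrite (subset_trans _ (cent_sub _)) // (subset_trans (subsetIr _ _)) ?centS.
have sZM : 'Z(P) \subset M by rewrite subsetI nQZ subsetIl.
have ntZ : 'Z(P) != 1.
  rewrite (center_nil_eq1 (pgroup_nil pP)); apply/trivgPn; exists x => //.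
have oZ : #|'Z(P)| = 3.
  have : #|'Z(P)| %| 3.
    rewrite -iM -(card_quotient (subsetIr _ _)).
    rewrite (card_isog (quotient_isog nQZ tiQZ)).
    by rewrite cardSg ?quotientS.
  by move/(prime_nt_dvdP (isT : prime 3)) => -> //; rewrite -trivg_card1.
have defM : Q * 'Z(P) = M.
  apply/eqP; rewrite eqEcard mulG_subG (proper_sub ltQM) sZM.
  by rewrite TI_cardMg // oZ -(Lagrange (proper_sub ltQM)) iM leqnn.
have ntQ : Q :!=: 1 by apply/trivgPn; exists x.
have ltMP : M \proper P.
  rewrite properE sMP subsetI subxx /=; apply/negP => nQP.
  have nsQP : Q <| P by rewrite /normal sQP.
  by have := meet_center_nil (pgroup_nil pP) nsQP ntQ; rewrite tiQZ eqxx.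
have oQ : #|Q| = 3.
  have := nilpotent_proper_norm (pgroup_nil pP) ltMP.
  case/properP=> _ [u /setIP[Pu nMu] nMu']; have Gu := subsetP sPG u Pu.
  have tiQu : Q :^ u :&: Q = 1.
    apply/trivgP/subsetP=> v /setIP[/imsetP[w Qw def_v] Qv].
    rewrite inE; apply: contraT => ntv; case/negP: nMu'.
    have ntw : w != 1 by rewrite -(conjg_eq1 w u) -def_v.
    have := stab_FixJ (Fix x) w u (subsetP sPG _ (subsetP sQP w Qw)) Gu.
    rewrite -def_v FixQ; last by apply/setD1P.
    rewrite FixQ; last by apply/setD1P.
    move=> /(_ erefl erefl)/setIP[_ nFu].
    rewrite inE Pu; apply/normP/eqP; rewrite eqEcard cardJg leqnn andbT.
    apply/subsetP=> _ /imsetP[q Qq ->]; apply: memQ.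
      exact: groupJ (subsetP sQP q Qq) Pu.
    have [-> | ntq] := eqVneq q 1; first by rewrite conj1g mem_Fix act1 eqxx Ob.
    rewrite -[b](actKV to u) mem_FixJ // FixQ; last by apply/setD1P.
    by rewrite (astabs_act _ (groupVr nFu)).
  have le3 : #|Q| <= 3.
    have sQuM : Q :^ u \subset M by rewrite -(normP nMu) conjSg proper_sub.
    have : #|(Q :^ u)%G * Q| <= #|M|.
      by rewrite subset_leq_card // mulG_subG sQuM proper_sub.
    by rewrite TI_cardMg // cardJg -(Lagrange (proper_sub ltQM)) iM leq_pmul2l.
  by move: le3 ntQ (pgroupS sQP pP); rewrite trivg_card1 /pgroup; case: #|Q| => [|[|[|[|]]]].
have ox : #[x] = 3.
  have := order_dvdG Qx; rewrite oQ => /(prime_nt_dvdP (isT : prime 3)) -> //.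
  by rewrite order_eq1.
have defQ : Q :=: <[x]> by apply/esym/eqP; rewrite eqEcard cycle_subG Qx oQ -orderE ox.
have oM : #|M| = 9 by rewrite -(Lagrange (proper_sub ltQM)) oQ iM.
have abM : abelian M by apply: (p2group_abelian (pgroupS sMP pP)); rewrite oM.
split=> //.
  have := proper_card ltMP; rewrite oM; have [k ->] := p_natP pP.
  by case: k => [|[|[|k]]] // _; rewrite (@leq_exp2l 3 3).
suffices defC : 'C_P[x] = M by rewrite defC oM -defQ defM.
apply/eqP; rewrite eqEsubset subsetI sMP sub_cent1.
rewrite (subsetP abM) ?(subsetP (proper_sub ltQM)) // andbT.
by rewrite /M /= -/Q defQ setIS // -cent_cycle cent_sub.
Qed.

(** Counting fixed points extends bigness from [P] to [G] in a conjugation-invariant way; including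
    1 makes the set closed under powers of its elements in [P], as transfer requires. *)
Local Notation X := [set g in G | (g == 1) || (#|Fix g| == #|F0| + 3)].

Let nXG : G \subset 'N(X).
Proof.
apply/subsetP=> h Gh; rewrite inE; apply/subsetP=> _ /imsetP[g /setIdP[Gg Xg] ->].
by rewrite inE groupJ // conjg_eq1 card_FixJ.
Qed.

Let XJ g h : g \in X -> h \in G -> g ^ h \in X.
Proof. by move=> Xg Gh; rewrite memJ_norm ?(subsetP nXG). Qed.

Let XV g : g \in X -> g^-1 \in X.
Proof. by rewrite !inE groupV invg_eq1 FixV. Qed.

Let mem_X g : g \in P^# -> (g \in X) = (Fix g != F0).
Proof.
move=> Pg; have [ntg Pg'] := setD1P Pg; rewrite inE (negPf ntg) (subsetP sPG) //=.
have [-> | [cF _]] := small_or_big g Pg.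
  by rewrite eqxx -{1}[#|F0|]addn0 eqn_add2l.
rewrite cF eqxx; apply/esym/eqP => eqF; move: cF; rewrite eqF => /eqP.
by rewrite -{1}[#|F0|]addn0 eqn_add2l.
Qed.

Let X_power : {in P :&: X, forall g k, g ^+ k \in X}.
Proof.
move=> g /setIP[Pg Xg] k; have Pgk : g ^+ k \in P by rewrite groupX.
have [-> | ntgk] := eqVneq (g ^+ k) 1; first by rewrite !inE group1 eqxx.
have ntg : g != 1 by apply: contraNneq ntgk => ->; rewrite expg1n.
have Pg1 : g \in P^# by apply/setD1P.
have Pgk1 : g ^+ k \in P^# by apply/setD1P.
rewrite mem_X //; move: Xg; rewrite mem_X //; apply: contra_neq => eqF.
by apply/eqP; rewrite eqEsubset sub_F0 // -eqF sub_FixX.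
Qed.

Let big_facts x : x \in P -> x \in X -> x != 1 ->
  [/\ #[x] = 3, 'C_P[x] = <[x]> * 'Z(P), #|'C_P[x]| = 9, #|'Z(P)| = 3 & #|P| >= 27].
Proof.
move=> Px Xx ntx; have Px1 : x \in P^# by apply/setD1P.
have bigx : Fix x != F0 by rewrite -mem_X.
have [b Fxb nF0b] : exists2 b, b \in Fix x & b \notin F0.
  by apply/subsetPn; apply: contra bigx => sFx; rewrite eqEsubset sFx sub_F0.
have [oQ oZ P27 defQ [defC oC]] := noncentral_big_stab x b Px1 bigx Fxb nF0b.
by split; rewrite // orderE -defQ.
Qed.

Let Delta_small a : a \notin F0 -> #|P| >= 27 -> (a \in Delta) = false.
Proof.
move=> nF0a P27; rewrite mem_Delta; apply/andP=> [[Oa le3]].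
have [C1 | ntC] := eqVneq 'C_P[a | to] 1.
  by move: le3; rewrite C1 indexg1 leqNgt (leq_trans _ P27).
have [u /setIP[Pu /astab1P ua] ntu] := trivgPn _ ntC.
have Fua : a \in Fix u by rewrite mem_Fix Oa ua eqxx.
have bigu : Fix u != F0 by apply: contraNneq nF0a => <-.
have [oC _ _ _ _] := noncentral_big_stab u a (introT setD1P (conj ntu Pu)) bigu Fua nF0a.
have := leq_mul (leqnn #|'C_P[a | to]|) le3.
by rewrite Lagrange ?subsetIl // oC leqNgt (leq_trans _ P27).
Qed.

(** * Big elements modulo the commutator subgroup *)

Section Commutator.

Variable x : gT.
Hypotheses (Px : x \in P) (Xx : x \in X) (ntx : x != 1).

Lemma index_der1_le9 (R : {group gT}) :
  R \subset P -> 'C_P[x] \subset R -> #|R : R^`(1)| %| 9.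
Proof.
move=> sRP sCR; have [_ _ oC _ _] := big_facts x Px Xx ntx.
have Rx : x \in R by rewrite (subsetP sCR) // inE Px cent1id.
have oR : #|R| = (9 * #|x ^: R|)%N.
  rewrite -index_cent1 -oC; have -> : 'C_R[x] = 'C_P[x].
    by rewrite -(setIidPr sRP) setIAC -[LHS]setIC (setIidPr sCR).
  by rewrite Lagrange.
have le_cl : #|x ^: R| <= #|R^`(1)|.
  rewrite -(card_lcoset _ x) subset_leq_card //; apply/subsetP=> _ /imsetP[r Rr ->].
  by rewrite mem_lcoset -commgEl mem_commg.
have le9 : #|R : R^`(1)| <= 9.
  by rewrite -(leq_pmul2l (cardG_gt0 R^`(1))) Lagrange ?der_sub // oR mulnC leq_pmul2r.
have [k oRR] := p_natP (pnat_dvd (dvdn_indexg R R^`(1)) (pgroupS sRP pP)).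
by move: le9; rewrite oRR; case: k {oRR} => [|[|[|k]]] //; rewrite (@leq_exp2l 3 _ 2).
Qed.

Lemma nonabelian_P : ~~ abelian P.
Proof.
have [_ _ oC oZ P27] := big_facts x Px Xx ntx.
by apply: contraL P27 => /center_idP <-; rewrite oZ.
Qed.

Lemma index_der1_P : #|P : P^`(1)| = 9.
Proof.
have := index_der1_le9 P (subxx _) (subsetIl _ _).
have ncyc : ~~ cyclic (P / P^`(1)).
  apply: contra nonabelian_P => /(cyclic_nilpotent_quo_der1_cyclic (pgroup_nil pP)).
  exact: cyclic_abelian.
rewrite -(card_quotient (normal_norm (der_normal 1 P))) => /dvdn9P[] // oPP.
  by case/negP: ncyc; move/eqP: oPP; rewrite -trivg_card1 => /eqP->; apply: cyclic1.
by case/negP: ncyc; rewrite prime_cyclic // oPP.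
Qed.

Lemma class_lcoset_der1 : x ^: P = x *: P^`(1).
Proof.
have [_ _ oC _ _] := big_facts x Px Xx ntx.
apply/eqP; rewrite eqEcard; apply/andP; split.
  by apply/subsetP=> _ /imsetP[r Pr ->]; rewrite mem_lcoset -commgEl mem_commg.
rewrite card_lcoset -index_cent1 -(leq_pmul2l (isT : 0 < 9)) -{2}oC.
by rewrite Lagrange ?subsetIl // mulnC -index_der1_P Lagrange ?der_sub.
Qed.

Lemma big_notin_der1 : x \notin P^`(1).
Proof.
apply/negP => P'x; have : 1 \in x ^: P.
  by rewrite class_lcoset_der1 mem_lcoset mulg1 groupV.
by case/imsetP=> p _ /eqP; rewrite eq_sym conjg_eq1 (negPf ntx).
Qed.

(** One of [w] and [w^-1] lies in the coset of [x], which consists of conjugates of [x]. *)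
Lemma big_index3_der1 (U : {group gT}) w : P^`(1) \subset U -> U \subset P ->
  #|U : P^`(1)| = 3 -> x \in U -> w \in U -> w \notin P^`(1) -> w \in X.
Proof.
move=> sP'U sUP iU Ux Uw nP'w; have nP'P := normal_norm (der_normal 1 P).
have nsP'U : P^`(1) <| U by rewrite /normal sP'U (subset_trans sUP).
have clX v : v \in x *: P^`(1) -> v \in X.
  rewrite -class_lcoset_der1 => /imsetP[p Pp ->].
  by rewrite XJ ?(subsetP sPG).
have Dx : x \in U :\: P^`(1) by apply/setDP; split=> //; apply: big_notin_der1.
have /orP[P'w | P'w] := index3_coset _ U _ x w nsP'U iU Dx Uw nP'w.
  by apply: clX; rewrite mem_lcoset.
rewrite -[w]invgK XV //; apply: clX; rewrite mem_lcoset -groupV invMg !invgK.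
have -> : w * x = (x * w) ^ x by rewrite conjgE !mulgA mulVg mul1g.
by rewrite memJ_norm ?(subsetP nP'P).
Qed.

Lemma center_sub_der1 : 'Z(P) \subset P^`(1).
Proof.
have [_ _ _ oZ _] := big_facts x Px Xx ntx.
have ntP' : P^`(1) != 1 by rewrite (sameP eqP derG1P) nonabelian_P.
have := meet_center_nil (pgroup_nil pP) (der_normal 1 P) ntP'.
apply: contraR => nsZ; rewrite -(setIC 'Z(P)); apply/eqP.
by apply: prime_TIg; rewrite ?oZ.
Qed.

Lemma odd_local (R : {group gT}) n : R \subset P -> 'C_P(R) \subset R -> x \in R ->
    3.-Sylow('N_G(R)) 'N_P(R) -> odd #|'N_G(R)| -> n \in 'N_G(R) ->
  x^-1 * x ^ n \in P^`(1).
Proof.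
move=> sRP cRR Rx sylN oddN Nn; have pR := pgroupS sRP pP.
have [_ defC _ _ _] := big_facts x Px Xx ntx.
have sCR : 'C_P[x] \subset R.
  rewrite defC mul_subG ?cycle_subG //; apply: subset_trans cRR.
  by rewrite setIS ?centS.
have iR := index_der1_le9 R sRP sCR.
have := norm_odd_sylow_cent _ R _ 'N_G(R)%G pR iR oddN (subsetIr _ _) sylN.
case/subsetP/(_ n Nn)/mulsgP=> p c /setIP[Pp nRp] /setIP[_ cRc] ->.
have Rxp : x ^ p \in R by rewrite memJ_norm.
by rewrite conjgM [_ ^ c]conjgE -(centP cRc _ Rxp) mulKg -commgEl mem_commg.
Qed.

End Commutator.

(** * Normal subgroups when no central element is big *)

Section NoCentralBigConclusions.

Variable x : gT.
Hypotheses (Px : x \in P) (Xx : x \in X) (ntx : x != 1).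

Let P27 : 27 <= #|P|. Proof. by case: (big_facts x Px Xx ntx). Qed.
Let abPP' : abelian (P / P^`(1)). Proof. by rewrite sub_der1_abelian. Qed.

(** [R] contains the small elements of ['Z(P)^#], so its fixed set is the single point [F0], which
    ['N_G(R)] fixes; hence ['N_G(R)] has odd order. Transfer to
    [P / P^](1)[leaves no big element in]P :&: N[, since none lies in]P^[(1)]. *)
Lemma noncentral_big_strongly_embedded : #|F0| = 1%N ->
  exists N : {group gT}, [/\ N <| G, #|G : N| %| 9,
    strongly_embedded 3 ('N_G(Delta | to) :&: N)%G N & 1 <= #|Delta| <= 4].
Proof.
move=> F01; have [_ _ _ oZ _] := big_facts x Px Xx ntx.
have [z Zz ntz] : exists2 z, z \in 'Z(P) & z != 1.
  by apply/trivgPn; rewrite trivg_card1 oZ.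
have [Pz cPz] := setIP Zz.
have defD : Delta = F0.
  apply/setP=> a; have [F0a | nF0a] := boolP (a \in F0); last exact: Delta_small.
  have [Oa /afixP fixa] := setIP F0a; rewrite mem_Delta Oa /=.
  suffices -> : 'C_P[a | to] = P by rewrite indexgg.
  by apply/setIidPl/subsetP=> g Pg; apply/astab1P/fixa.
have loc (R : {group gT}) : R \subset P -> 'C_P(R) \subset R ->
    3.-Sylow('N_G(R)) 'N_P(R) ->
    {in 'N_G(R) & R :&: X, forall n r, r^-1 * r ^ n \in P^`(1)}.
  move=> sRP cRR sylN n r Nn /setIP[Rr Xr].
  have [-> | ntr] := eqVneq r 1; first by rewrite conj1g mulg1 invg1.
  apply: (odd_local r (subsetP sRP r Rr) Xr ntr R) => //.
  have FixR : 'Fix_(Omega | to)(R) = F0.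
    apply/eqP; rewrite eqEsubset (setIS _ (afixS _ sRP)) andbT.
    rewrite -(smallZ z) ?setIS ?afixS // ?sub1set; last by apply/setD1P.
    by rewrite (subsetP cRR) // inE Pz (subsetP (centS sRP)).
  apply: odd_no_involution => t Nt; apply: (no_involution_odd F0); rewrite ?subsetIl ?F01 //.
  by rewrite -FixR norm_FixG.
have fus := local_fusion _ _ _ _ sylP X _ nXG loc.
have [N nsNG [iN sPNX]] :=
  transfer_kernel _ _ _ _ _ X sylP (der_normal 1 P) abPP' X_power fus.
rewrite (index_der1_P x Px Xx ntx) in iN; exists N; rewrite defD F01; split=> //.
rewrite -defD; apply: strongly_embedded_fix => //.
- by rewrite defD -card_gt0 F01.
- by apply: pnat_dvd iN _.
- apply: setI_neq1_index => //; apply: leq_ltn_trans (dvdn_leq _ iN) _ => //.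
  exact: leq_trans P27.
move=> w /setD1P[ntw PNw]; have Pw : w \in P by case/setIP: PNw.
have Pw1 : w \in P^# by apply/setD1P.
rewrite defD; apply/eqP; apply: contraT; rewrite -mem_X // => Xw.
have /negP[] := big_notin_der1 w Pw Xw ntw.
by apply: (subsetP sPNX); apply/setIP.
Qed.

(** For proper [R] containing a big element, the image of [R] modulo
    [P^](1)[has order 3, so all elements of]R[outside]P^[(1)] are big. By [involution_fix_pair] an
    involution in ['N_G(R)] would centralise or invert one of them and preserve its three fixed
    points. As [F0] is empty, elements of order 3 with fixed points are conjugate to big elements of
    [P], and [N] contains none of these. *)
Lemma fusion_index3_normal (Q : {group gT}) :
    #|F0| = 0 -> Q <| P -> #|P : Q| = 3 -> P^`(1) \subset Q -> Q :&: X \subset [1] ->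
    {in 'N_G(P) & P :&: X, forall n r, r^-1 * r ^ n \in Q} ->
  exists N : {group gT}, [/\ N <| G, #|G : N| %| 3
    & {in Omega, forall a, ~~ (3 %| #|N :&: 'C_G[a | to]|)}].
Proof.
move=> F00 nsQP iQ sP'Q tiQX locP.
have loc (R : {group gT}) : R \subset P -> 'C_P(R) \subset R ->
    3.-Sylow('N_G(R)) 'N_P(R) ->
    {in 'N_G(R) & R :&: X, forall n r, r^-1 * r ^ n \in Q}.
  move=> sRP cRR sylN n r Nn /setIP[Rr Xr].
  have [-> | ntr] := eqVneq r 1; first by rewrite conj1g mulg1 invg1.
  have Pr := subsetP sRP r Rr.
  have [eqRP | neqRP] := eqVneq (R : {set gT}) P.
    by apply: locP; [rewrite -eqRP | rewrite inE Pr].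
  apply: (subsetP sP'Q); apply: (odd_local r Pr Xr ntr R) => //.
  have nP'P := normal_norm (der_normal 1 P).
  have ltRP' : R <*> P^`(1) \proper P.
    rewrite properEneq join_subG sRP der_sub !andbT; apply: contra_neq neqRP => defP.
    suffices : <<R>> = P by rewrite genGid.
    apply: Phi_nongen; apply/eqP; rewrite eqEsubset join_subG Phi_sub sRP /=.
    rewrite -{1}defP joingC; apply: genS; apply: setSU; exact: (der1_sub_Phi _ _ _ pP).
  have iRP' : #|R <*> P^`(1) : P^`(1)| = 3.
    have := index_der1_P r Pr Xr ntr.
    rewrite -(Lagrange_index (proper_sub ltRP') (joing_subr R _)) => i9.
    have : #|R <*> P^`(1) : P^`(1)| %| 9 by rewrite -i9 dvdn_mull.
    case/dvdn9P=> // iR.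
      move/eqP: iR; rewrite indexg_eq1 join_subG subxx andbT => /subsetP/(_ r Rr).
      by rewrite (negPf (big_notin_der1 r Pr Xr ntr)).
    move/eqP: i9; rewrite iR -[9]mul1n eqn_pmul2r // indexg_eq1.
    by case/properP: ltRP' => _ [p Pp /negP nRp] /subsetP/(_ p Pp).
  have nP'R := subset_trans sRP nP'P.
  have nsW : R :&: P^`(1) <| R by rewrite /normal subsetIl normsI ?normG.
  have iW : #|R : R :&: P^`(1)| = 3.
    rewrite indexgI -(card_quotient nP'R) -quotientYidr // card_quotient //.
    by rewrite join_subG nP'R normG.
  have X_D w : w \in R :\: (R :&: P^`(1)) -> w \in X /\ w != 1.
    case/setDP=> Rw; rewrite in_setI Rw /= => nw.
    split; last by apply: contraNneq nw => ->.
    apply: (big_index3_der1 r Pr Xr ntr (R <*> P^`(1))%G) => //.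
    - exact: joing_subr.
    - exact: proper_sub.
    - exact: (subsetP (joing_subl R _)).
    exact: (subsetP (joing_subl R _)).
  apply: odd_no_involution => t /setIP[Gt nRt] ot.
  have oddW : odd #|R :&: P^`(1)|.
    have := pgroupS (subset_trans (subsetIl R P^`(1)) sRP) pP.
    by move/p_natP=> [k ->]; rewrite oddX orbT.
  have [|w Dw wt] := involution_fix_pair _ R (R :&: P^`(1))%G t nsW iW oddW ot.
    apply/subsetP=> _ /imsetP[w Dw ->]; have [Xw ntw] := X_D w Dw.
    have [Rw _] := setDP Dw; have Rwt : w ^ t \in R by rewrite memJ_norm.
    apply/setDP; split=> //; rewrite in_setI Rwt /=.
    by apply: big_notin_der1; rewrite ?(subsetP sRP) ?XJ ?conjg_eq1.
  have [Xw ntw] := X_D w Dw; have [Rw _] := setDP Dw.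
  have Gw : w \in G by rewrite (subsetP sPG) ?(subsetP sRP).
  apply: (no_involution_odd (Fix w) t) ot; first exact: subsetIl.
    by move: Xw; rewrite inE (negPf ntw) F00 => /andP[_ /eqP->].
  by apply: (stab_FixJ _ w) => //; case: wt => ->; rewrite ?FixV.
have fus := local_fusion _ _ _ _ sylP X Q nXG loc.
have abPQ : abelian (P / Q) by rewrite sub_der1_abelian.
have [N nsNG [iN sPNX]] := transfer_kernel _ _ _ _ Q X sylP nsQP abPQ X_power fus.
rewrite iQ in iN; exists N; split=> // a Oa.
apply/negP => /Cauchy[] // g /setIP[Ng /setIP[Gg /astab1P ga]] og.
have [||h Gh] := Sylow_Jsub sylP (_ : <[g]> \subset G) _; rewrite ?cycle_subG //.
  by rewrite /pgroup -orderE og.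
rewrite -cycleJ cycle_subG => Pgh; have ntgh : g ^ h != 1 by rewrite conjg_eq1 -order_gt1 og.
have Xgh : g ^ h \in X.
  rewrite mem_X; last by apply/setD1P.
  apply/eqP=> eqF; have : to a h \in Fix (g ^ h) by rewrite mem_FixJ // mem_Fix Oa ga eqxx.
  by rewrite eqF (cards0_eq F00) inE.
have Ngh : g ^ h \in N by rewrite memJ_norm // (subsetP (normal_norm nsNG)).
have : g ^ h \in [1].
  apply/(subsetP tiQX)/setIP; split=> //; apply: (subsetP sPNX).
  by apply/setIP; split=> //; apply/setIP.
by rewrite inE (negPf ntgh).
Qed.

Section Index3Normal.

Hypothesis F00 : #|F0| = 0.

Let odd_stab w g : w \in P -> w \in X -> w != 1 -> g \in 'N_G(Fix w | to) -> odd #[g].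
Proof.
move=> Pw Xw ntw nFg; apply: odd_no_involution => t gt ot.
apply: (no_involution_odd (Fix w) t) ot; first exact: subsetIl.
  by move: Xw; rewrite inE (negPf ntw) F00 => /andP[_ /eqP->].
by apply: subsetP gt; rewrite cycle_subG.
Qed.

(** Otherwise [class_lcoset_der1] corrects [g] by an element of [P] so that it inverts [w]. It then
    preserves the three points of [Fix w], so has odd order, against [conj_inv_odd]. *)
Lemma inverted_der1 w g : w \in P -> w \in X -> w != 1 -> g \in 'N_G(P) ->
  w * w ^ g \notin P^`(1).
Proof.
move=> Pw Xw ntw /setIP[Gg nPg]; apply/negP => P'w.
have Gw := subsetP sPG w Pw.
have : w ^ g \in w^-1 *: P^`(1) by rewrite mem_lcoset invgK.
rewrite -(class_lcoset_der1 w^-1) ?groupV ?XV ?invg_eq1 // => /imsetP[p Pp def_wg].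
have wk : w ^ (g * p^-1) = w^-1 by rewrite conjgM def_wg conjgK.
have odd_k : odd #[g * p^-1].
  apply: (odd_stab w) => //; apply: (stab_FixJ _ w) => //; last by rewrite wk FixV.
  by rewrite groupM ?groupV // (subsetP sPG).
have w2 := conj_inv_odd _ _ _ wk odd_k; have [ow _ _ _ _] := big_facts w Pw Xw ntw.
by case/eqP: ntw; have := expg_order w; rewrite ow expgS w2 mulg1.
Qed.

(** Otherwise some element of the coset of [t] modulo [P] centralises [w], hence has odd order,
    which puts the involution [t] into [P]. *)
Lemma centralized_der1 w t : w \in P -> w \in X -> w != 1 -> t \in 'N_G(P) ->
  #[t] = 2 -> w^-1 * w ^ t \notin P^`(1).
Proof.
move=> Pw Xw ntw /setIP[Gt nPt] ot; apply/negP => P'w.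
have Gw := subsetP sPG w Pw.
have : w ^ t \in w *: P^`(1) by rewrite mem_lcoset.
rewrite -(class_lcoset_der1 w) // => /imsetP[p Pp def_wt].
have wk : w ^ (t * p^-1) = w by rewrite conjgM def_wt conjgK.
have odd_k : odd #[t * p^-1].
  apply: (odd_stab w) => //; apply: (stab_FixJ _ w) => //; last by rewrite wk.
  by rewrite groupM ?groupV // (subsetP sPG).
have nPk : t * p^-1 \in 'N(P) by rewrite groupM // groupV (subsetP (normG P)).
have eq_tk : coset P t = coset P (t * p^-1) by rewrite coset_kerr ?groupV.
have : odd #[coset P t].
  by rewrite eq_tk; apply: dvdn_odd odd_k; apply: morph_order.
have dv2 : #[coset P t] %| 2 by rewrite -ot; apply: (morph_order (coset_morphism P)).
move=> oddc; have : #[coset P t] = 1%N.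
  by move: dv2 oddc; rewrite dvdn_divisors // !inE => /orP[] /eqP->.
move/eqP; rewrite order_eq1 => /eqP/(coset_idr nPt) Pt.
by have := mem_p_elt pP Pt; rewrite /p_elt ot.
Qed.

(** Take [b] outside ['Z(P)] but central modulo it. Its centraliser has index at most 3, so contains
    some [w] outside [P^](1)[, and]'C_P[w] = <[w]> * 'Z(P)[shows that]b[is outside]P^[(1)] too. So
    [b] is big, its centraliser has order 9, and [#|P| <= 27]. *)
Lemma extraspecial27 : {in P :\: P^`(1), forall w, w \in X} ->
  [/\ extraspecial P, exponent P = 3 & #|P| = 27].
Proof.
move=> allX; have [_ _ _ oZ _] := big_facts x Px Xx ntx.
have iP' := index_der1_P x Px Xx ntx.
have sZP' := center_sub_der1 x Px Xx ntx.
have XX w : w \in P -> w \notin P^`(1) -> w \in X by move=> Pw nw; apply/allX/setDP.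
have nt w : w \notin P^`(1) -> w != 1 by move=> nw; apply: contraNneq nw => ->.
have nZP : P \subset 'N('Z(P)) := normal_norm (center_normal P).
have [b Pb [nZb cbZ]] : exists2 b, b \in P
    & b \notin 'Z(P) /\ {in P, forall p, [~ b, p] \in 'Z(P)}.
  have : 'Z(P / 'Z(P)) != 1.
    rewrite (center_nil_eq1 (quotient_nil _ (pgroup_nil pP))) -subG1 quotient_sub1 //.
    apply: contra (nonabelian_P x Px Xx ntx) => sPZ; apply/center_idP/eqP.
    by rewrite eqEsubset subsetIl.
  case/trivgPn=> _ /setIP[/morphimP[b Nb Pb ->] cb] ntb; exists b => //; split.
    by apply: contra ntb => Zb; apply/eqP/coset_id.
  move=> p Pp; have Np := subsetP nZP p Pp; apply: coset_idr; first by rewrite groupR.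
  rewrite morphR //; apply/eqP/commgP/(centP cb); exact: mem_quotient.
have le3 : #|P : 'C_P[b]| <= 3.
  rewrite index_cent1 -oZ -(card_lcoset _ b) subset_leq_card //.
  by apply/subsetP=> _ /imsetP[p Pp ->]; rewrite mem_lcoset -commgEl cbZ.
have [w /setIP[Pw cbw] nw] : exists2 w, w \in 'C_P[b] & w \notin P^`(1).
  apply/subsetPn; apply: contraL le3 => sCP'; rewrite -ltnNge.
  by apply: (@leq_trans 9) => //; rewrite -iP' dvdn_leq ?indexgS.
have [_ defC _ _ _] := big_facts w Pw (XX w Pw nw) (nt w nw).
have nb : b \notin P^`(1).
  apply/negP=> P'b; have : b \in 'C_P[w] by rewrite inE Pb cent1C.
  rewrite defC => /mulsgP[_ z /cycleP[i ->] Zz def_b].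
  have [wi1 | ntwi] := eqVneq (w ^+ i) 1; first by rewrite def_b wi1 mul1g Zz in nZb.
  have Xwi : w ^+ i \in X by apply: X_power; apply/setIP; split; last exact: XX.
  have /negP[] := big_notin_der1 (w ^+ i) (groupX i Pw) Xwi ntwi.
  by rewrite -(groupMr _ (subsetP sZP' z Zz)) -def_b.
have [_ _ oCb _ _] := big_facts b Pb (XX b Pb nb) (nt b nb).
have oP : #|P| = 27.
  apply/eqP; rewrite eqn_leq P27 andbT -(Lagrange (subsetIl P 'C[b])) oCb.
  by rewrite (leq_mul2l 9 _ 3).
have oP' : #|P^`(1)| = 3.
  by apply/eqP; rewrite -(eqn_pmul2r (isT : 0 < 9)) -{1}iP' Lagrange ?der_sub ?oP.
have exp3 : exponent P %| 3.
  apply/exponentP=> g Pg; have [P'g | nP'g] := boolP (g \in P^`(1)).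
    by rewrite -oP' expg_cardG.
  by have [<- _ _ _ _] := big_facts g Pg (XX g Pg nP'g) (nt g nP'g); rewrite expg_order.
split=> //; first exact: (card_p3group_extraspecial (isT : prime 3)).
apply: (prime_nt_dvdP (isT : prime 3)) exp3; rewrite -dvdn1 -trivg_exponent.
by apply/trivgPn; exists x.
Qed.

(* If N_G(P) contains an involution t, the elements of X in P lie neither in  *)
(* the subgroup of P / P' inverted by t nor in the one centralised by t; in   *)
(* these coordinates N_G(P) cannot change the sign of the centralised part of *)
(* an element of X.                                                           *)
Lemma even_norm_index3 t : t \in 'N_G(P) -> #[t] = 2 ->
  exists Q : {group gT}, [/\ P^`(1) \subset Q, Q \subset P, #|P : Q| = 3,
      Q :&: X \subset [1]
    & {in 'N_G(P) & P :&: X, forall n r, r^-1 * r ^ n \in Q}].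
Proof.
move=> Nt ot; have [Gt nPt] := setIP Nt.
have iP' := index_der1_P x Px Xx ntx.
have nP'P := normal_norm (der_normal 1 P).
have tt w : (w ^ t) ^ t = w.
  by have := expg_order t; rewrite ot expgS expg1 -conjgM => ->; rewrite conjg1.
have Pt w : w \in P -> w ^ t \in P by move=> Pw; rewrite memJ_norm.
have nP't : t \in 'N(P^`(1)).
  by rewrite (subsetP (char_norm_trans (der_char 1 P) (subxx _))).
pose Q0 := [set w in P | w * w ^ t \in P^`(1)].
have gQ : group_set Q0.
  apply/group_setP; split=> [|u v]; first by rewrite !inE conj1g mulg1 !group1.
  case/setIdP=> Pu P'u /setIdP[Pv P'v]; rewrite inE groupM //= conjMg.
  have -> : u * v * (u ^ t * v ^ t) = (u * u ^ t) * (v * v ^ t) * [~ v, u ^ t] ^ (v ^ t).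
    by move: (u ^ t) (v ^ t) => p q; rewrite commgEl !conjgE ?invMg ?invgK !mulgA
  ?(mulgK, mulgKV, mulVg, mul1g).
  rewrite groupM ?(groupM P'u) // memJ_norm ?mem_commg ?Pt //.
  by rewrite (subsetP nP'P) ?Pt.
pose Q := Group gQ; have sQP : Q \subset P by apply/subsetP=> w /setIdP[].
have sP'Q : P^`(1) \subset Q.
  apply/subsetP=> w P'w; rewrite inE (subsetP (der_sub 1 P)) //=.
  by rewrite groupM // memJ_norm.
have XQ w : w \in P -> w \in X -> w != 1 -> w \notin Q.
  move=> Pw Xw ntw; have := inverted_der1 w t Pw Xw ntw Nt.
  by apply: contra => /setIdP[].
have Qe w : w \in P -> w * (w ^ t)^-1 \in Q.
  move=> Pw; rewrite inE groupM ?groupV ?Pt //= conjMg conjVg tt.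
  by rewrite mulgA mulgKV mulgV group1.
have i9 : (#|P : Q| * #|Q : P^`(1)|)%N = 9 by rewrite Lagrange_index.
have iQ' : #|Q : P^`(1)| = 3.
  have : #|Q : P^`(1)| %| 9 by rewrite -i9 dvdn_mull.
  case/dvdn9P=> // i.
    have := centralized_der1 x t Px Xx ntx Nt ot.
    have P'e : x * (x ^ t)^-1 \in P^`(1).
      by move/eqP: i; rewrite indexg_eq1 => /subsetP; apply; apply: Qe.
    case/negP; have -> : x^-1 * x ^ t = ((x * (x ^ t)^-1)^-1) ^ x.
      by move: (x ^ t) => p; rewrite conjgE ?invMg ?invgK !mulgA
  ?(mulgK, mulgKV, mulVg, mul1g).
    by rewrite memJ_norm ?groupV // (subsetP nP'P).
  have /negP[] := XQ x Px Xx ntx; suffices /subsetP sPQ : P \subset Q by apply: sPQ.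
  by rewrite -indexg_eq1 -(eqn_pmul2r (isT : 0 < 9)) -{1}i i9.
have iQ : #|P : Q| = 3.
  by apply/eqP; rewrite -(eqn_pmul2r (isT : 0 < 3)) -{1}iQ' i9.
have nsQP : Q <| P := sub_der1_normal sP'Q sQP.
have nsP'Q : P^`(1) <| Q by rewrite /normal sP'Q (subset_trans sQP).
exists Q; split=> //.
  apply/subsetP=> w /setIP[Qw Xw]; rewrite inE; apply: contraT => ntw.
  by have := XQ w (subsetP sQP w Qw) Xw ntw; rewrite Qw.
move=> h w Nh /setIP[Pw Xw]; have [Gh nPh] := setIP Nh.
have [-> | ntw] := eqVneq w 1; first by rewrite conj1g mulg1 invg1.
have Pwh : w ^ h \in P by rewrite memJ_norm.
have Xwh : w ^ h \in X by rewrite XJ.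
have ntwh : w ^ h != 1 by rewrite conjg_eq1.
have PQw : w \in P :\: Q by apply/setDP; split=> //; apply: XQ.
have /orP[// | Qv] := index3_coset _ P Q w (w ^ h) nsQP iQ PQw Pwh (XQ _ Pwh Xwh ntwh).
set e := w * (w ^ t)^-1; have Qe' : e \in Q by apply: Qe.
have nP'e : e \notin P^`(1).
  have := centralized_der1 w t Pw Xw ntw Nt ot; apply: contra => P'e.
  have -> : w^-1 * w ^ t = (e^-1) ^ w.
    by rewrite /e; move: (w ^ t) => p; rewrite conjgE ?invMg ?invgK !mulgA
  ?(mulgK, mulgKV, mulVg, mul1g).
  by rewrite memJ_norm ?groupV // (subsetP nP'P).
have nP'v := inverted_der1 w h Pw Xw ntw Nh.
have QPe : e \in Q :\: P^`(1) by apply/setDP.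
have /orP[P'ev | P'ev] := index3_coset _ Q _ e _ nsP'Q iQ' QPe Qv nP'v.
  have Nht : h * t^-1 \in 'N_G(P) by rewrite groupM ?groupV.
  case/negP: (inverted_der1 w _ Pw Xw ntw Nht).
  have -> : w * w ^ (h * t^-1) = (e^-1 * (w * w ^ h)) ^ t^-1.
    rewrite conjgM -[X in X * _](conjgK t w) -conjMg /e; congr (_ ^ _).
    by move: (w ^ t) (w ^ h) => p q; rewrite invMg invgK !mulgA !mulgKV.
  by rewrite memJ_norm ?groupV.
case/negP: (centralized_der1 (w ^ h) t Pwh Xwh ntwh Nt ot).
have P'e3 : e ^+ 3 \in P^`(1).
  apply: coset_idr; first by rewrite groupX // (subsetP nP'P) ?(subsetP sQP).
  rewrite morphX ?(subsetP nP'P) ?(subsetP sQP) //.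
  by rewrite -iQ' -(card_quotient (normal_norm nsP'Q)) expg_cardG ?mem_quotient.
set s := e * (w * w ^ h) in P'ev.
have -> : (w ^ h)^-1 * (w ^ h) ^ t = s^-1 * e ^+ 3 * s ^ t.
  have -> : s ^ t = w ^ t * w^-1 * (w ^ t * (w ^ h) ^ t).
    by rewrite (conjMg e) (conjMg w (w ^ t)^-1) (conjMg w (w ^ h)) (conjVg (w ^ t)) tt.
  rewrite /s /e !expgS expg0; move: (w ^ t) (w ^ h) ((w ^ h) ^ t) => p q r.
  by rewrite !invMg invgK mulg1 !mulgA !(mulgK, mulgKV).
by rewrite groupM ?memJ_norm // groupM ?groupV.
Qed.

(** If ['N_G(P)] has odd order and some [w] outside
    [P^](1)[is small, take]Q[generated by]w[and]P^[(1)]: a big element in it would make [w] big by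
    [big_index3_der1]. *)
Lemma index3_normal_or_extraspecial :
  (exists Q : {group gT}, [/\ P^`(1) \subset Q, Q \subset P, #|P : Q| = 3,
      Q :&: X \subset [1]
    & {in 'N_G(P) & P :&: X, forall n r, r^-1 * r ^ n \in Q}])
  \/ [/\ extraspecial P, exponent P = 3 & #|P| = 27].
Proof.
have [evenN | oddN] := boolP (2 %| #|'N_G(P)|).
  by have [t Nt ot] := Cauchy (isT : prime 2) evenN; left; apply: even_norm_index3 ot.
rewrite dvdn2 negbK in oddN.
have [allX | /subsetPn[w /setDP[Pw nP'w] nXw]] := boolP (P :\: P^`(1) \subset X).
  by right; apply: extraspecial27; apply/subsetP.
have sP'P := der_sub 1 P; have nP'P := normal_norm (der_normal 1 P).
pose Q := (<[w]> <*> P^`(1))%G; left; exists Q.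
have sP'Q : P^`(1) \subset Q := joing_subr _ _.
have sQP : Q \subset P by rewrite join_subG cycle_subG Pw.
have nP'w' := subsetP nP'P w Pw.
have i9 : (#|P : Q| * #|Q : P^`(1)|)%N = 9.
  by rewrite Lagrange_index // (index_der1_P x).
have iQ' : #|Q : P^`(1)| = 3.
  have : #|Q : P^`(1)| %| 9 by rewrite -i9 dvdn_mull.
  case/dvdn9P=> // i.
    move/eqP: i; rewrite indexg_eq1 join_subG cycle_subG => /andP[P'w _].
    by rewrite P'w in nP'w.
  have /eqP defP : P == Q :> {set gT}.
    rewrite eqEsubset sQP -indexg_eq1 -(eqn_pmul2r (isT : 0 < 9)) -{1}i i9 //.
  case/negP: (nonabelian_P x Px Xx ntx); apply: cyclic_abelian.
  apply: (cyclic_nilpotent_quo_der1_cyclic (pgroup_nil pP)).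
  have -> : P / P^`(1) = <[w]> / P^`(1).
    apply: etrans (congr1 (fun A : {set gT} => A / P^`(1)) defP) _.
    by rewrite quotientYidr ?cycle_subG.
  by rewrite quotient_cyclic ?cycle_cyclic.
have iQ : #|P : Q| = 3.
  by apply/eqP; rewrite -(eqn_pmul2r (isT : 0 < 3)) -{1}iQ' i9.
have nsP'Q : P^`(1) <| Q by rewrite /normal sP'Q (subset_trans sQP).
split=> //.
  apply/subsetP=> v /setIP[Qv Xv]; rewrite inE; apply: contraT => ntv.
  have Pv := subsetP sQP v Qv; case/negP: nXw.
  apply: (big_index3_der1 v Pv Xv ntv Q) => //.
  by rewrite (subsetP (joing_subl _ _)) ?cycle_id.
move=> n r Nn /setIP[Pr Xr]; have [-> | ntr] := eqVneq r 1.
  by rewrite conj1g mulg1 invg1.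
apply: (subsetP sP'Q); apply: (odd_local r Pr Xr ntr P) => //; first exact: subsetIl.
have -> : 'N_P(P) = P by apply/setIidPl/normG.
by apply: pHall_subl sylP; rewrite ?subsetIl // subsetI sPG normG.
Qed.

End Index3Normal.

End NoCentralBigConclusions.

End NoCentralBig.

(** * Sylow subgroups of order 3 and the final case division *)

(** A Sylow 2-subgroup of ['N_G(P)] preserves [F0], of size at most 4, and the stabiliser of [a] in
    it is trivial, having odd order. *)
Lemma card3_normaliser2 a : #|P| = 3 -> a \in F0 -> #|'N_G(P)|`_2 <= 4.
Proof.
move=> oP F0a; have [Oa /afixP fixa] := setIP F0a.
have [w Pw ntw] : exists2 w, w \in P & w != 1 by apply/trivgPn; rewrite trivg_card1 oP.
have Gw := subsetP sPG w Pw.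
have leF0 : #|F0| <= 4.
  by rewrite (leq_trans (subset_leq_card (sub_F0 w Pw))) // fix4 //; apply/setD1P.
have [T sylT] := Sylow_exists 2 'N_G(P); rewrite -(card_Hall sylT).
have [sTN pT _] := and3P sylT; have sTG := subset_trans sTN (subsetIl _ _).
have oddT : odd #|'C_T[a | to]| by apply: dvdn_odd (oddG_ a Oa); rewrite cardSg ?setSI.
have T1 : #|'C_T[a | to]| = 1%N.
  have := pgroupS (subsetIl T 'C[a | to]) pT; rewrite /pgroup => /p_natP[k oT].
  by move: oddT; rewrite oT; case: k {oT} => // k; rewrite expnS oddM.
apply: leq_trans leF0; rewrite -(Lagrange (subsetIl T 'C[a | to])) T1 mul1n -card_orbit.
apply/subset_leq_card/subsetP=> _ /imsetP[t Tt ->].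
have /setIP[_ nFt] := norm_FixG P t (subsetP sTN t Tt).
by rewrite (astabs_act _ nFt).
Qed.

(** An element of order 3 in the stabiliser of [alpha], conjugated into [P], has a fixed point; so
    [F0] is nonempty or some element is big. *)
Lemma fixity4_cases alpha : alpha \in Omega -> 3 %| #|'C_G[alpha | to]| ->
  [\/ exists N : {group gT}, [/\ N <| G, #|G : N| %| 3
        & {in Omega, forall a, ~~ (3 %| #|N :&: 'C_G[a | to]|)}],
      exists N : {group gT}, [/\ N <| G, #|G : N| %| 9,
        strongly_embedded 3 ('N_G(Delta | to) :&: N)%G N & 1 <= #|Delta| <= 4],
      #|P| = 3 /\ #|'N_G(P)|`_2 <= 4
    | 3.-abelem P /\ #|P| = 9 \/ [/\ extraspecial P, exponent P = 3 & #|P| = 27]].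
Proof.
move=> Oalpha /Cauchy[] // g /setIP[Gg /astab1P galpha] og.
have [||h Gh] := Sylow_Jsub sylP (_ : <[g]> \subset G) _; rewrite ?cycle_subG //.
  by rewrite /pgroup -orderE og.
rewrite -cycleJ cycle_subG; set v := g ^ h => Pv.
have ov : #[v] = 3 by rewrite orderJ.
have ntv : v != 1 by rewrite -order_gt1 ov.
have Pv1 : v \in P^# by apply/setD1P.
have [a Fva] : exists a, a \in Fix v.
  by exists (to alpha h); rewrite mem_FixJ // mem_Fix Oalpha galpha eqxx.
have le4 w : w \in P^# -> #|Fix w| <= 4.
  by case/setD1P=> ntw Pw; apply: fix4; apply/setD1P; split=> //; apply: subsetP Pw.
have dv3 : 3 %| #|P| by rewrite -ov order_dvdG.
have [oP | neq3] := eqVneq #|P| 3.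
  constructor 3; split=> //; apply: (card3_normaliser2 a oP).
  have defP : <[v]> = P by apply/eqP; rewrite eqEcard cycle_subG Pv -orderE ov oP.
  by rewrite -defP Fix_cycle.
have P9 : 9 <= #|P|.
  by move: dv3 neq3; have [[|[|k]] ->] := p_natP pP => // _ _; rewrite (@leq_exp2l 3 2).
have [/existsP[x /andP[Px1 bigx]] | nobig] :=
  boolP [exists x, (x \in P^#) && (Fix x != F0)]; last first.
  have fixP : {in P^#, forall w, Fix w = F0}.
    move=> w Pw; apply/eqP; apply: contraR nobig => bigw.
    by apply/existsP; exists w; rewrite Pw.
  have F0a : a \in F0 by rewrite -(fixP v).
  have ntF0 : F0 != set0 by apply/set0Pn; exists a.
  have [defD SE] := strongly_embedded_small P9 ntF0 fixP.
  constructor 2; exists G; split; rewrite ?normal_refl ?indexgg //.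
  by rewrite defD card_gt0 ntF0 -(fixP v) // le4.
have [/existsP[z /andP[Zz bigz]] | nobigZ] :=
  boolP [exists z, (z \in 'Z(P)^#) && (Fix z != F0)].
  have [/andP[/eqP oP abP] | nabP] := boolP ((#|P| == 9) && 3.-abelem P).
    by constructor 4; left.
  have [|N [nsN iN SE cD]] := central_big_strongly_embedded z Zz bigz P9.
    by move=> oP; move: nabP; rewrite oP.
  by constructor 2; exists N; split=> //; apply: dvdn_trans iN _.
have smallZ : {in 'Z(P)^#, forall z, Fix z = F0}.
  move=> z Zz; apply/eqP; apply: contraR nobigZ => bigz.
  by apply/existsP; exists z; rewrite Zz.
have [ntx Px] := setD1P Px1.
have [eqF | [cF le1]] := small_or_big x Px1; first by rewrite eqF eqxx in bigx.
have Xx : x \in [set g in G | (g == 1) || (#|Fix g| == #|F0| + 3)].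
  by rewrite inE (subsetP sPG) // cF eqxx orbT.
have [F00 | F0n0] := eqVneq #|F0| 0; last first.
  have F01 : #|F0| = 1%N by apply/eqP; rewrite eqn_leq le1 lt0n.
  by constructor 2; apply: (noncentral_big_strongly_embedded smallZ x Px Xx ntx F01).
have [[Q [sP'Q sQP iQ tiQ locQ]] | xs27] :=
  index3_normal_or_extraspecial smallZ x Px Xx ntx F00.
  constructor 1; apply: (fusion_index3_normal smallZ Q F00) => //.
  exact: sub_der1_normal.
by constructor 4; right.
Qed.

End Fixity.

Theorem theorem1p1 (gT : finGroupType) (rT : finType)
    (to : {action gT &-> rT}) (G : {group gT}) (Omega : {set rT})
    (trG : [transitive G, on Omega | to])
    (ffG : [faithful G, on Omega | to])
    (fixG : has_fixity to G Omega 4)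
    (P : {group gT}) (sylP : 3.-Sylow(G) P)
    (alpha : rT) (Omega_alpha : alpha \in Omega) :
  let Delta : {set rT} :=
    \bigcup_(O in orbit to P @: Omega | #|O| <= 3) O in
  let K : {group gT} := 'N_G(Delta | to)%G in
  (* (a) *)
  2 %| #|'C_G[alpha | to]|
  (* (b) *)
  \/ (exists2 N : {group gT}, N <|<| G &
        [/\ N <| G, #|G : N| %| 3 & gcdn #|N :&: 'C_G[alpha | to]| 6 = 1%N]
     \/ [/\ #|G : N| %| 9, strongly_embedded 3 (K :&: N)%G N
          & 1 <= #|Delta| <= 4])
  (* (c) *)
  \/ [\/ #|P| = 3 /\ #|'N_G(P)|`_2 <= 4,
         3.-abelem P /\ #|P| = 9,
         [/\ extraspecial P, exponent P = 3 & #|P| = 27]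
       | P \isog [set: wreath 'Z_3 'Z_3]].
Proof.
move=> Delta K; have [even_alpha | odd_alpha] := boolP (2 %| #|'C_G[alpha | to]|).
  by left.
right; rewrite dvdn2 negbK in odd_alpha; have [_ fix4] := fixG.
have oddG_ : {in Omega, forall a, odd #|'C_G[a | to]|}.
  move=> a Oa; have [g Gg ->] := atransP2 trG Omega_alpha Oa.
  suffices <- : 'C_G[alpha | to] :^ g = 'C_G[to alpha g | to] by rewrite cardJg.
  by rewrite conjIg (conjGid Gg) -astab1_act.
have coprime6 (N : {group gT}) : ~~ (3 %| #|N :&: 'C_G[alpha | to]|) ->
    gcdn #|N :&: 'C_G[alpha | to]| 6 = 1%N.
  move=> n3; apply/eqP; rewrite -/(coprime _ (2 * 3)) coprimeMr.
  rewrite !(coprime_sym #|_|) !prime_coprime // n3 andbT dvdn2 negbK.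
  by apply: dvdn_odd odd_alpha; rewrite cardSg ?subsetIr.
have [dv3 | ndv3] := boolP (3 %| #|'C_G[alpha | to]|); last first.
  left; exists G; first exact: subnormal_refl.
  by left; rewrite normal_refl indexgg coprime6 // setIA setIid.
have [[N [nsN iN n3]] | [N [nsN iN SE cD]] | c1 | [c2 | c3]] :=
    fixity4_cases _ _ to G P Omega trG ffG fix4 oddG_ sylP alpha Omega_alpha dv3.
- left; exists N; first exact: normal_subnormal.
  by left; split=> //; apply: coprime6; apply: n3.
- by left; exists N; [apply: normal_subnormal | right].
- by right; constructor 1.
- by right; constructor 2.
by right; constructor 3.
Qed.
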